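(* Let $K\in\mathbb{R}^{m\times n}$ and $H_{cl}:=H+BK$. Suppose there exist a diagonal positive definite matrix $P\in\mathbb{R}^{n\times n}$, a diagonal positive definite matrix $T\in\mathbb{R}^{m\times m}$, scalars $\mu,\chi,\alpha>0$, and a symmetric positive definite matrix $\Gamma\in\mathbb{R}^{n\times n}$ such that $$\begin{pmatrix} H_{cl}^\top P\Lambda H_{cl}-e^{-\mu}P\Lambda & H_{cl}^\top P\Lambda B-K^\top T\\ (H_{cl}^\top P\Lambda B-K^\top T)^\top & B^\top P\Lambda B-2T\end{pmatrix}\le 0,$$ $$\begin{pmatrix}\Gamma & PN\\ N^\top P & \chi^2 I\end{pmatrix}\ge 0,\qquad P(\alpha I-\mu\Lambda)+\Gamma\le 0 .$$ Then, for every mild solution pair $(X,d)$ of the closed-loop system $\dot X=\mathcal{A}X+\mathcal{N}d$ with initial condition $X(0)=X_0$, and for all $t\in\mathrm{dom}\,X$, $$\|X(t)\|_{\mathcal{L}^2(0,1;\mathbb{R}^n)}\le\kappa e^{-\omega t}\|X_0\|_{\mathcal{L}^2(0,1;\mathbb{R}^n)}+\gamma\sqrt{\int_0^t\|d(\theta)\|^2_{\mathcal{L}^2(0,1;\mathbb{R}^q)}\,d\theta},$$ with $$\omega=\frac{\alpha}{2},\qquad \kappa=\sqrt{\frac{\lambda_{\max}(P)}{\lambda_{\min}(P)}}\,e^{\mu/2},\qquad \gamma=\frac{\chi}{\sqrt{\lambda_{\min}(P)}}\,e^{\mu/2}.$$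
   Context: Data: $\Lambda\in\mathbb{R}^{n\times n}$ is diagonal positive definite, $H\in\mathbb{R}^{n\times n}$, $B\in\mathbb{R}^{n\times m}$, $N\in\mathbb{R}^{n\times q}$. For symmetric matrices, $\ge 0$ and $\le 0$ mean positive and negative semidefinite; $\lambda_{\max},\lambda_{\min}$ denote the largest and smallest eigenvalues. Saturation levels $\overline u_1,\dots,\overline u_m>0$ are given; $\sigma:\mathbb{R}^m\to\mathbb{R}^m$ is defined by $\sigma(u)_i=\min(|u_i|,\overline u_i)\,\mathrm{sign}(u_i)$, and $\phi(u):=\sigma(u)-u$. Operators: $\mathcal{A}X:=-\Lambda X_z$ with domain $\mathcal{D}(\mathcal{A}):=\{X\in\mathcal{H}^1(0,1;\mathbb{R}^n):\ X(0)=H_{cl}X(1)+B\phi(KX(1))\}$; $\mathcal{N}:\mathcal{L}^2(0,1;\mathbb{R}^q)\to\mathcal{L}^2(0,1;\mathbb{R}^n)$, $(\mathcal{N}d)(z)=Nd(z)$. $\epsilon$-approximate solution on $[0,\bar T]$, for $\epsilon>0$ and $f:=\mathcal{N}d\in\mathcal{L}^1(0,\bar T;\mathcal{L}^2(0,1;\mathbb{R}^n))$: choose a partition $0=t_0<t_1<\dots<t_M\le \bar T$ with $t_i-t_{i-1}<\epsilon$ for all $i$ and $\bar T-\epsilon<t_M\le \bar T$, and elements $f_1,\dots,f_M\in\mathcal{L}^2(0,1;\mathbb{R}^n)$ with $\sum_{i=1}^M\int_{t_{i-1}}^{t_i}\|f(s)-f_i\|\,ds<\epsilon$. An $\epsilon$-approximate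 solution with initial condition $X_0$ is a piecewise constant function $w:[0,t_M]\to\mathcal{L}^2(0,1;\mathbb{R}^n)$ with $w(0)=w_0$, $w=w_i$ on $(t_{i-1},t_i]$, where $w_i\in\mathcal{D}(\mathcal{A})$ and $\frac{w_i-w_{i-1}}{t_i-t_{i-1}}=\mathcal{A}w_i+f_i$ for $i=1,\dots,M$, and $\|w_0-X_0\|\le\epsilon$. Mild solution pair: a pair $(X,d)$ with $\mathrm{dom}\,X=\mathrm{dom}\,d=I$, where $I$ is $[0,\bar T]$ ($\bar T>0$) or $[0,\infty)$, $X\in\mathcal{C}(I;\mathcal{L}^2(0,1;\mathbb{R}^n))$, $d\in\mathcal{L}^1(I;\mathcal{L}^2(0,1;\mathbb{R}^q))$, $X(0)=X_0\in\mathcal{L}^2(0,1;\mathbb{R}^n)$, such that for each $\epsilon>0$ there is an $\epsilon$-approximate solution $w$ of $\dot X=\mathcal{A}X+\mathcal{N}d$ with $\|X(t)-w(t)\|\le\epsilon$ for all $t$ in the domain of $w$ (when $I=[0,\infty)$, this is required of the restriction of $(X,d)$ to $[0,\bar T]$, for every $\bar T>0$). The integral $\int_0^t\|d(\theta)\|^2d\theta$ is taken in $[0,\infty]$, the bound being vacuous when it is infinite. *)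

(* Defs.v *)
From HB Require Import structures.
From mathcomp Require Import all_boot all_order all_algebra.
From mathcomp Require Import all_classical all_reals all_analysis.

Set Implicit Arguments.
Unset Strict Implicit.
Unset Printing Implicit Defensive.
Import Order.TTheory GRing.Theory Num.Theory.
Import numFieldNormedType.Exports.
Local Open Scope classical_set_scope.
Local Open Scope ring_scope.

Section matrices.
Context {R : realType}.

Definition symmetric_mx k (M : 'M[R]_k) := M^T = M.

Definition psdmx k (M : 'M[R]_k) :=
  symmetric_mx M /\ forall v : 'cV[R]_k, 0 <= (v^T *m M *m v) 0 0.

Definition nsdmx k (M : 'M[R]_k) :=
  symmetric_mx M /\ forall v : 'cV[R]_k, (v^T *m M *m v) 0 0 <= 0.

Definition pdmx k (M : 'M[R]_k) :=
  symmetric_mx M /\ forall v : 'cV[R]_k, v != 0 -> 0 < (v^T *m M *m v) 0 0.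

Definition diag_pdmx k (M : 'M[R]_k) := is_diag_mx M /\ pdmx M.

(* Meaningful for symmetric M and k > 0: the set of eigenvalues is then finite
   and nonempty, so that these bounds are attained. *)
Definition lambda_max k (M : 'M[R]_k) : R := sup [set a | eigenvalue M a].
Definition lambda_min k (M : 'M[R]_k) : R := inf [set a | eigenvalue M a].

Definition sat m (ubar u : 'cV[R]_m) : 'cV[R]_m :=
  \col_i (Num.min `|u i 0| (ubar i 0) * Num.sg (u i 0)).

Definition deadzone m (ubar u : 'cV[R]_m) : 'cV[R]_m := sat ubar u - u.

End matrices.

(* Elements of L2(0,1;R^k) are given by representatives [X : R -> 'cV[R]_k], of
   which only the values on ]0,1[ matter, and equality in L2 is [eqL2]. *)
Section spaces.
Context {R : realType}.
Local Notation mu := (@lebesgue_measure R).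

Definition inL2 k (X : R -> 'cV[R]_k) :=
  (forall i, measurable_fun (`]0, 1[%classic : set R) (fun z => X z i 0)) /\
  (\int[mu]_(z in `]0%R, 1%R[) (\sum_(i < k) X z i 0 ^+ 2)%:E < +oo)%E.

Definition normL2 k (X : R -> 'cV[R]_k) : R :=
  Num.sqrt (\int[mu]_(z in `]0, 1[) (\sum_(i < k) X z i 0 ^+ 2)).

Definition eqL2 k (X Y : R -> 'cV[R]_k) := ae_eq mu `]0, 1[%classic X Y.

(* C^1 functions with compact support in ]0,1[: Brezis' choice of test functions
   for the Sobolev spaces of an interval. *)
Definition test_function (phi : R -> R) :=
  [/\ forall z, derivable phi z 1,
      continuous (derive1 phi) &
      exists a b : R, [/\ 0 < a, b < 1 &
        forall z, z \notin `[a, b] -> phi z = 0]].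

Definition weak_derivative k (X G : R -> 'cV[R]_k) :=
  forall phi, test_function phi -> forall i,
    \int[mu]_(z in `]0, 1[) (X z i 0 * derive1 phi z) =
    - \int[mu]_(z in `]0, 1[) (G z i 0 * phi z).

(* X is in H^1(0,1;R^k) and G is (a representative of) X_z. *)
Definition inH1_with k (X G : R -> 'cV[R]_k) :=
  [/\ inL2 X, inL2 G & weak_derivative X G].

(* The boundary values X(0), X(1) of an element of H^1(0,1;R^k) are those of its
   representative which is continuous on [0,1]. *)
Definition continuous_repr k (X Xc : R -> 'cV[R]_k) :=
  eqL2 X Xc /\ forall i, {within `[0, 1], continuous (fun z => Xc z i 0)}.

(* Continuity of I -> L2(0,1;R^k), t |-> X t, for the L2 norm. *)
Definition continuous_L2 k (I : set R) (X : R -> R -> 'cV[R]_k) :=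
  (forall t, I t -> inL2 (X t)) /\
  forall t0, I t0 ->
    (fun t => normL2 (X t \- X t0)) @ within I (nbhs t0) --> (0 : R).

Definition simple_L2 k (s : R -> R -> 'cV[R]_k) :=
  exists (r : nat) (A : 'I_r -> set R) (g : 'I_r -> R -> 'cV[R]_k),
    [/\ forall j, measurable (A j),
        forall j, inL2 (g j) &
        forall t z, s t z = \sum_(j < r) \1_(A j) t *: g j z].

(* Strong (Bochner) measurability of t |-> d t.  As for L2, a class of functions
   of t modulo null sets is given by a representative, here a Borel one: every
   strongly Lebesgue-measurable function agrees almost everywhere with a
   pointwise limit of simple functions over Borel sets. *)
Definition strongly_measurable_L2 k (I : set R) (d : R -> R -> 'cV[R]_k) :=
  exists s : nat -> R -> R -> 'cV[R]_k,
    (forall j, simple_L2 (s j)) /\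
    forall t, I t -> (fun j => normL2 (d t \- s j t)) @ \oo --> (0 : R).

(* d is in L1(I; L2(0,1;R^k)). *)
Definition inL1L2 k (I : set R) (d : R -> R -> 'cV[R]_k) :=
  [/\ forall t, I t -> inL2 (d t),
      strongly_measurable_L2 I d &
      mu.-integrable I (fun t => (normL2 (d t))%:E)].

End spaces.

Section system.
Context {R : realType} {n m q : nat}.
Variables (Lambda Hcl : 'M[R]_n) (B : 'M[R]_(n, m)) (K : 'M[R]_(m, n)).
Variables (ubar : 'cV[R]_m) (N : 'M[R]_(n, q)).
Local Notation mu := (@lebesgue_measure R).

(* X is in D(A) and Y is (a representative of) A X = - Lambda X_z. *)
Definition opA (X Y : R -> 'cV[R]_n) :=
  exists G Xc : R -> 'cV[R]_n,
    [/\ inH1_with X G, continuous_repr X Xc,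
        Xc 0 = Hcl *m Xc 1 + B *m deadzone ubar (K *m Xc 1) &
        eqL2 Y (fun z => - (Lambda *m G z))].

Definition opN (d : R -> 'cV[R]_q) : R -> 'cV[R]_n := fun z => N *m d z.

(* w, defined on [0, tM], is an eps-approximate solution on [0, Tbar] of
   dX/dt = A X + f with initial condition X0; t_0, ..., t_M and w_0, ..., w_M are
   given by [t] and [W], and f_1, ..., f_M by [g 0], ..., [g (M - 1)]. *)
Definition approx_solution (eps Tbar : R) (X0 : R -> 'cV[R]_n)
    (f : R -> R -> 'cV[R]_n) (tM : R) (w : R -> R -> 'cV[R]_n) :=
  exists (M : nat) (t : nat -> R) (g W : nat -> R -> 'cV[R]_n),
    [/\ [/\ (0 < M)%N, t 0%N = 0, t M = tM &
            forall i, (i < M)%N -> t i < t i.+1 /\ t i.+1 - t i < eps],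
        Tbar - eps < tM /\ tM <= Tbar,
        (forall i, (i < M)%N -> inL2 (g i)) /\
        (\sum_(i < M) \int[mu]_(s in `]t i, t i.+1])
           (normL2 (f s \- g i))%:E < eps%:E)%E,
        [/\ w 0 = W 0%N,
            forall (i : nat) (s : R), (i < M)%N -> t i < s -> s <= t i.+1 ->
              w s = W i.+1 &
            forall i, (i < M)%N -> exists2 Y, opA (W i.+1) Y &
              eqL2 (fun z => (t i.+1 - t i)^-1 *: (W i.+1 z - W i z))
                   (Y \+ g i)] &
        inL2 (W 0%N) /\ normL2 (W 0%N \- X0) <= eps].

Definition mild_on (Tbar : R) (X0 : R -> 'cV[R]_n)
    (X : R -> R -> 'cV[R]_n) (d : R -> R -> 'cV[R]_q) :=
  forall eps : R, 0 < eps -> exists (tM : R) (w : R -> R -> 'cV[R]_n),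
    approx_solution eps Tbar X0 (fun s => opN (d s)) tM w /\
    forall t, 0 <= t <= tM -> normL2 (X t \- w t) <= eps.

(* (X, d), with dom X = dom d = I, is a mild solution pair of
   dX/dt = A X + N d, X(0) = X0. *)
Definition mild_solution_pair (I : set R) (X0 : R -> 'cV[R]_n)
    (X : R -> R -> 'cV[R]_n) (d : R -> R -> 'cV[R]_q) :=
  [/\ inL2 X0, continuous_L2 I X, inL1L2 I d, eqL2 (X 0) X0 &
      (exists2 Tbar : R, 0 < Tbar & I = `[0, Tbar]%classic /\ mild_on Tbar X0 X d) \/
      (I = `[0, +oo[%classic /\ forall Tbar : R, 0 < Tbar -> mild_on Tbar X0 X d)].

End system.

(* Main.v *)
Require Import Defs.
From HB Require Import structures.
From mathcomp Require Import all_boot all_order all_algebra.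
From mathcomp Require Import all_classical all_reals all_analysis.
From mathcomp Require Import measurable_realfun ring lra.

Import Order.TTheory GRing.Theory Num.Theory.
Import numFieldNormedType.Exports.
Local Open Scope classical_set_scope.
Local Open Scope ring_scope.

Set Implicit Arguments.
Unset Strict Implicit.
Unset Printing Implicit Defensive.

(** The energy V(X) = ∫_0^1 e^(-mu z) X^T P X dz decays along the exact flow up to
the supply chi^2 |d|^2, and the implicit Euler scheme that defines mild
solutions inherits this dissipation step by step; the estimate is then passed
to the limit.

Along the transport equation, integration by parts turns
2 ∫ e^(-mu z) X^T P (-Lambda X_z) into - mu ∫ e^(-mu z) X^T P Lambda X plus the
boundary term X(0)^T P Lambda X(0) - e^(-mu) X(1)^T P Lambda X(1). The first
matrix inequality and the sector condition phi_i sigma_i <= 0 of the deadzone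
make this boundary term nonpositive ([boundary_dissipation]). The second
inequality is Young's inequality for the disturbance ([disturbance_young]) and
the third one bounds - mu P Lambda + Gamma by - alpha P ([wdot_decay]).

For an implicit Euler step W' -> W of length h, the inequality
V(W) - V(W') <= 2 <W, W - W'>_V ([wdot_increment]) replaces the chain rule, so
that the same computation applies to W alone ([energy_step]). The source g of
the step is not of the form N d, but the defect is at most a multiple of
|W| |N d(s) - g| for each time s; integrated over the steps these defects sum to
O(eps), because the W are uniformly close to the continuous, hence bounded,
trajectory. A discrete Gronwall lemma gives, at a node s of the partition with
t - eps < s <= t,
V(w(s)) <= e^(-alpha s / (1 + alpha eps)) V(w(0)) + chi^2 ∫_0^t |d|^2 + O(eps)
([approx_energy_bound]). Nodes after t would be of no use: d need not be
square-integrable beyond t. With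
e^(-mu) lambda_min(P) |X|^2 <= V(X) <= lambda_max(P) |X|^2 and eps -> 0 this is
the theorem.

Elements of the domain of the generator are only weakly differentiable. That
the continuous representative is a primitive of the weak derivative follows by
testing against explicit C^1 plateau functions that converge to the indicator of
an interval ([weak_derivative_primitive]). The product rule for primitives of
integrable functions comes from a local-to-global argument on intervals
([interval_induction], [primitive_mul]). *)

(** * Integrable functions on the unit interval *)

Section unit_interval.
Context {R : realType}.
Local Notation leb := (@lebesgue_measure R).

Definition int01 (f : R -> R) := leb.-integrable `]0, 1[ (EFin \o f).

Lemma int01D (f g : R -> R) : int01 f -> int01 g -> int01 (fun z => f z + g z).
Proof. by move=> hf hg; have := integrableD _ hf hg; apply. Qed.

Lemma int01B (f g : R -> R) : int01 f -> int01 g -> int01 (fun z => f z - g z).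
Proof. by move=> hf hg; have := integrableB _ hf hg; apply. Qed.

Lemma int01Z (c : R) (f : R -> R) : int01 f -> int01 (fun z => c * f z).
Proof. by move=> hf; have := integrableZl _ c hf; apply. Qed.

Lemma int01_sum I (s : seq I) (f : I -> R -> R) :
  (forall i, int01 (f i)) -> int01 (fun z => \sum_(i <- s) f i z).
Proof.
move=> hf; rewrite /int01.
have -> : EFin \o (fun z => \sum_(i <- s) f i z) =
          (fun z => \sum_(i <- s) (f i z)%:E)%E.
  by apply/funext => z /=; rewrite sumEFin.
by apply: integrable_sum => // i _; exact: hf.
Qed.

Lemma int01_abs (f : R -> R) : int01 f -> int01 (fun z => `|f z|).
Proof. by move=> hf; have := integrable_norm hf; apply. Qed.

Lemma int01_cst (c : R) : int01 (fun=> c).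
Proof.
apply: measurable_bounded_integrable => //.
  by rewrite /= lebesgue_measure_itv/= lte_fin ltr01 -EFinB ltry.
by exists `|c|; split=> // M cM t _ /=; exact: ltW.
Qed.

(** From 2 |f g| <= f^2 + g^2. *)
Lemma int01M (f g : R -> R) :
  measurable_fun (`]0, 1[%classic : set R) f ->
  measurable_fun (`]0, 1[%classic : set R) g ->
  int01 (fun z => f z ^+ 2) -> int01 (fun z => g z ^+ 2) ->
  int01 (fun z => f z * g z).
Proof.
move=> mf mg f2 g2.
have h : int01 (fun z => f z ^+ 2 + g z ^+ 2).
  by rewrite /int01; have := integrableD _ f2 g2; apply.
apply: le_integrable h => //.
  by apply/measurable_EFinP; exact: measurable_funM.
move=> z _ /=; rewrite lee_fin normrM [leRHS]ger0_norm ?addr_ge0 ?sqr_ge0//.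
rewrite -[f z ^+ 2]real_normK ?num_real// -[g z ^+ 2]real_normK ?num_real//.
by have := sqr_ge0 (`|f z| - `|g z|); nra.
Qed.

Lemma int01S (f : R -> R) (x y : R) : 0 <= x -> y <= 1 -> int01 f ->
  leb.-integrable `]x, y[ (EFin \o f).
Proof.
move=> x0 y1; apply: integrableS => // z /=; rewrite !in_itv/= => /andP[xz zy].
by apply/andP; split; lra.
Qed.

End unit_interval.

(** * Square-integrable vector fields *)

Section l2_closure.
Context {R : realType}.
Local Notation leb := (@lebesgue_measure R).

Lemma inL2P k (X : R -> 'cV[R]_k) : inL2 X <-> forall i,
  measurable_fun (`]0, 1[%classic : set R) (fun z => X z i 0) /\
  int01 (fun z => X z i 0 ^+ 2).
Proof.
split=> [[mX iX] i|h]; split=> //.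
- have mS : measurable_fun (`]0, 1[%classic : set R)
      (fun z => \sum_(i < k) X z i 0 ^+ 2).
    apply: measurable_sum => j; apply: measurable_funX; exact: mX.
  have h : int01 (fun z => \sum_(i < k) X z i 0 ^+ 2).
    apply/integrableP; split; first exact/measurable_EFinP.
    rewrite (_ : (\int[_]_(_ in _) _)%E =
      \int[leb]_(z in `]0%R, 1%R[) (\sum_(i < k) X z i 0 ^+ 2)%:E)%E//.
    apply: eq_integral => z _ /=; rewrite ger0_norm//.
    by apply: sumr_ge0 => j _; exact: sqr_ge0.
  apply: le_integrable h => //.
    by apply/measurable_EFinP; apply: measurable_funX; exact: mX.
  move=> z _ /=; rewrite lee_fin ger0_norm ?sqr_ge0// ger0_norm; last first.
    by apply: sumr_ge0 => j _; exact: sqr_ge0.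
  rewrite (bigD1 i)//= lerDl; apply: sumr_ge0 => j _; exact: sqr_ge0.
- by move=> i; have [] := h i.
- apply: integrable_lty => //.
  by apply: int01_sum => i; have [] := h i.
Qed.

Lemma inL2_comp k (X : R -> 'cV[R]_k) i : inL2 X ->
  measurable_fun (`]0, 1[%classic : set R) (fun z => X z i 0).
Proof. by move/inL2P => /(_ i)[]. Qed.

(** Every quadratic expression in square-integrable fields is integrable; all
closure properties of L2 below are reduced to this one. *)
Lemma inL2_int2 k l (X : R -> 'cV[R]_k) (Y : R -> 'cV[R]_l) i j :
  inL2 X -> inL2 Y -> int01 (fun z => X z i 0 * Y z j 0).
Proof.
by move=> /inL2P/(_ i)[mX iX] /inL2P/(_ j)[mY iY]; apply: int01M.
Qed.

Lemma inL2_int01 k (X : R -> 'cV[R]_k) i : inL2 X -> int01 (fun z => X z i 0).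
Proof.
move=> /inL2P/(_ i)[mX iX].
rewrite (_ : (fun z => _) = fun z => 1 * X z i 0); last first.
  by apply/funext => z; rewrite mul1r.
by apply: int01M => //; rewrite expr1n; exact: int01_cst.
Qed.

Lemma inL2D k (X Y : R -> 'cV[R]_k) : inL2 X -> inL2 Y -> inL2 (X \+ Y).
Proof.
move=> hX hY; apply/inL2P => i; split.
  rewrite (_ : (fun z => _) = (fun z => X z i 0) \+ (fun z => Y z i 0)).
    by apply: measurable_funD; apply: inL2_comp.
  by apply/funext => z; rewrite /= mxE.
rewrite (_ : (fun z => _) =
  fun z => (X z i 0 * X z i 0 + Y z i 0 * Y z i 0) + 2 * (X z i 0 * Y z i 0)).
  by do ?[apply: int01D|apply: int01Z]; apply: inL2_int2.
by apply/funext => z; rewrite /= mxE; ring.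
Qed.

Lemma inL2M k l (M : 'M[R]_(l, k)) (X : R -> 'cV[R]_k) :
  inL2 X -> inL2 (fun z => M *m X z).
Proof.
move=> hX; apply/inL2P => i; split.
  rewrite (_ : (fun z => _) = fun z => \sum_(j < k) M i j * X z j 0).
    apply: measurable_sum => j; apply: measurable_funM => //.
    exact: inL2_comp.
  by apply/funext => z; rewrite mxE.
rewrite (_ : (fun z => _) = fun z => \sum_(j < k) \sum_(j' < k)
   M i j * (M i j' * (X z j 0 * X z j' 0))).
  apply: int01_sum => j; apply: int01_sum => j'.
  by do 2! apply: int01Z; apply: inL2_int2.
apply/funext => z; rewrite mxE expr2 big_distrl/=; apply: eq_bigr => j _.
rewrite big_distrr/=; apply: eq_bigr => j' _; ring.
Qed.

Lemma inL2Z k (c : R) (X : R -> 'cV[R]_k) : inL2 X -> inL2 (fun z => c *: X z).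
Proof.
move=> hX; rewrite (_ : (fun z => _) = fun z => c%:M *m X z); first exact: inL2M.
by apply/funext => z; rewrite mul_scalar_mx.
Qed.

Lemma inL2N k (X : R -> 'cV[R]_k) : inL2 X -> inL2 (fun z => - X z).
Proof.
move=> hX; rewrite (_ : (fun z => _) = fun z => -1 *: X z); first exact: inL2Z.
by apply/funext => z; rewrite scaleN1r.
Qed.

Lemma inL2B k (X Y : R -> 'cV[R]_k) : inL2 X -> inL2 Y -> inL2 (X \- Y).
Proof. by move=> hX hY; apply: inL2D => //; exact: inL2N. Qed.

End l2_closure.

(** * Bilinear forms of matrices *)

Section bilinear.
Context {R : realType}.
Local Notation leb := (@lebesgue_measure R).

Definition bil k l (M : 'M[R]_(k, l)) (x : 'cV[R]_k) (y : 'cV[R]_l) : R :=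
  (x^T *m M *m y) 0 0.

Lemma mxform k l (M : 'M[R]_(k, l)) (x : 'cV[R]_k) (y : 'cV[R]_l) :
  (x^T *m M *m y) 0 0 = \sum_i \sum_j M i j * (x i 0 * y j 0).
Proof.
rewrite mxE exchange_big/=; apply: eq_bigr => j _.
rewrite mxE big_distrl/=; apply: eq_bigr => i _; rewrite mxE; ring.
Qed.

Lemma bilDl k l (M : 'M[R]_(k, l)) x y z : bil M (x + y) z = bil M x z + bil M y z.
Proof. by rewrite /bil linearD /= !mulmxDl mxE. Qed.

Lemma bilDr k l (M : 'M[R]_(k, l)) x y z : bil M x (y + z) = bil M x y + bil M x z.
Proof. by rewrite /bil mulmxDr mxE. Qed.

Lemma bilNr k l (M : 'M[R]_(k, l)) x y : bil M x (- y) = - bil M x y.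
Proof. by rewrite /bil mulmxN mxE. Qed.

Lemma bilNl k l (M : 'M[R]_(k, l)) x y : bil M (- x) y = - bil M x y.
Proof. by rewrite /bil linearN /= !mulNmx mxE. Qed.

Lemma bilDm k l (M M' : 'M[R]_(k, l)) x y : bil (M + M') x y = bil M x y + bil M' x y.
Proof. by rewrite /bil mulmxDr mulmxDl mxE. Qed.

Lemma bilNm k l (M : 'M[R]_(k, l)) x y : bil (- M) x y = - bil M x y.
Proof. by rewrite /bil mulmxN mulNmx mxE. Qed.

Lemma bilZm k l (M : 'M[R]_(k, l)) c x y : bil (c *: M) x y = c * bil M x y.
Proof. by rewrite /bil -scalemxAr -scalemxAl mxE. Qed.

Lemma bilMr k l l' (M : 'M[R]_(k, l)) (A : 'M[R]_(l, l')) x y :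
  bil (M *m A) x y = bil M x (A *m y).
Proof. by rewrite /bil !mulmxA. Qed.

Lemma bilMl k l k' (M : 'M[R]_(k, l)) (A : 'M[R]_(k, k')) x y :
  bil (A^T *m M) x y = bil M (A *m x) y.
Proof. by rewrite /bil trmx_mul !mulmxA. Qed.

Lemma mxformC k l (M : 'M[R]_(k, l)) (x : 'cV[R]_k) (y : 'cV[R]_l) :
  (x^T *m M *m y) 0 0 = (y^T *m M^T *m x) 0 0.
Proof.
rewrite !mxform exchange_big; apply: eq_bigr => j _; apply: eq_bigr => i _.
by rewrite mxE (mulrC (x i 0)).
Qed.

Lemma bilC k l (M : 'M[R]_(k, l)) x y : bil M x y = bil M^T y x.
Proof. exact: mxformC. Qed.

Lemma bil_block k l (A : 'M[R]_k) (B : 'M[R]_(k, l)) C (D : 'M[R]_l) x y :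
  bil (block_mx A B C D) (col_mx x y) (col_mx x y) =
  bil A x x + bil B x y + bil C y x + bil D y y.
Proof.
rewrite /bil tr_col_mx mul_row_block mul_row_col !mulmxDl !mxE; ring.
Qed.

Lemma bil_diag k (M : 'M[R]_k) x y : is_diag_mx M ->
  bil M x y = \sum_i M i i * (x i 0 * y i 0).
Proof.
move=> /is_diag_mxP dM; rewrite /bil mxform; apply: eq_bigr => i _.
rewrite (bigD1 i)//= big1 ?addr0// => j ji.
by rewrite dM ?mul0r// eq_sym.
Qed.

Lemma psd1 k : psdmx (1%:M : 'M[R]_k).
Proof.
split; first by rewrite /symmetric_mx trmx1.
move=> v; rewrite mulmx1 mxE; apply: sumr_ge0 => i _.
by rewrite mxE -expr2 sqr_ge0.
Qed.

Lemma pd_psd k (M : 'M[R]_k) : pdmx M -> psdmx M.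
Proof.
move=> [sM h]; split=> // v; have [->|/h/ltW//] := eqVneq v 0.
by rewrite mulmx0 mxE.
Qed.

Lemma diag_entry_gt0 k (M : 'M[R]_k) i : diag_pdmx M -> 0 < M i i.
Proof.
move=> [dM [_ h]]; have := h (delta_mx i 0).
rewrite -/(bil _ _ _) bil_diag// (bigD1 i)//= big1 ?addr0.
  rewrite mxE !eqxx mulr1 mulr1; apply.
  by apply/eqP => /matrixP/(_ i 0); rewrite !mxE !eqxx => /eqP; rewrite oner_eq0.
by move=> j /negPf ji; rewrite mxE ji mul0r mulr0.
Qed.

Lemma diag_mul_sym k (M N : 'M[R]_k) : is_diag_mx M -> is_diag_mx N ->
  symmetric_mx (M *m N).
Proof.
move=> /diag_mxP[d ->] /diag_mxP[e ->].
by rewrite /symmetric_mx mulmx_diag tr_diag_mx.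
Qed.

End bilinear.

(** * Weighted bilinear forms on L2 *)

Section weighted_forms.
Context {R : realType}.
Local Notation leb := (@lebesgue_measure R).

(** With M = P this is the inner product of the Lyapunov functional, and with
mu = 0, M = 1 the one of L2 ([normL2_sqr]). Rectangular M are allowed so that
cross terms between state and disturbance are of the same kind. *)
Definition wdot k l (mu : R) (M : 'M[R]_(k, l))
    (X : R -> 'cV[R]_k) (Y : R -> 'cV[R]_l) :=
  \int[leb]_(z in `]0, 1[) (expR (- (mu * z)) * ((X z)^T *m M *m Y z) 0 0).

Lemma measurable_exp_weight (mu : R) D : measurable_fun D (fun z : R => expR (- (mu * z))).
Proof.
apply: measurable_funTS; apply: (measurableT_comp (f := expR)) => //.
by apply: measurableT_comp => //; apply: mulrl_measurable.
Qed.

Lemma int01_weight (mu : R) (f : R -> R) : 0 <= mu -> int01 f ->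
  int01 (fun z => expR (- (mu * z)) * f z).
Proof.
move=> mu0 hf; apply: le_integrable (hf) => //.
  apply/measurable_EFinP; apply: measurable_funM; first exact: measurable_exp_weight.
  by have /integrableP[/measurable_EFinP] := hf.
move=> z /=; rewrite in_itv/= => /andP[z0 z1].
rewrite lee_fin normrM ler_piMl// ger0_norm ?expR_ge0//.
by rewrite expR_le1 oppr_le0 mulr_ge0// ltW.
Qed.

Lemma int01_wdot k l (mu : R) (M : 'M[R]_(k, l)) X Y : 0 <= mu ->
  inL2 X -> inL2 Y ->
  int01 (fun z => expR (- (mu * z)) * ((X z)^T *m M *m Y z) 0 0).
Proof.
move=> mu0 hX hY; apply: int01_weight => //.
rewrite (_ : (fun z => _) = fun z => \sum_i \sum_j M i j * (X z i 0 * Y z j 0)).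
  do 2! (apply: int01_sum => ?).
  by apply: int01Z; apply: inL2_int2.
by apply/funext => z; rewrite mxform.
Qed.

Lemma eq_wdot k l k' l' (mu : R) (M : 'M[R]_(k, l)) (M' : 'M[R]_(k', l')) X Y X' Y' :
  (forall z, ((X z)^T *m M *m Y z) 0 0 = ((X' z)^T *m M' *m Y' z) 0 0) ->
  wdot mu M X Y = wdot mu M' X' Y'.
Proof. by move=> h; apply: eq_Rintegral => z _; rewrite h. Qed.

Lemma wdotDr k l (mu : R) (M : 'M[R]_(k, l)) X Y Z :
  0 <= mu -> inL2 X -> inL2 Y -> inL2 Z ->
  wdot mu M X (Y \+ Z) = wdot mu M X Y + wdot mu M X Z.
Proof.
move=> mu0 hX hY hZ; rewrite -RintegralD//; try exact: int01_wdot.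
by apply: eq_Rintegral => z _; rewrite mulmxDr mxE mulrDr.
Qed.

Lemma wdotZr k l (mu : R) (M : 'M[R]_(k, l)) X Y c :
  0 <= mu -> inL2 X -> inL2 Y ->
  wdot mu M X (fun z => c *: Y z) = c * wdot mu M X Y.
Proof.
move=> mu0 hX hY; rewrite -RintegralZl//; last exact: int01_wdot.
by apply: eq_Rintegral => z _; rewrite -scalemxAr mxE mulrCA.
Qed.

Lemma wdotNr k l (mu : R) (M : 'M[R]_(k, l)) X Y : 0 <= mu ->
  inL2 X -> inL2 Y -> wdot mu M X (fun z => - Y z) = - wdot mu M X Y.
Proof.
move=> mu0 hX hY; rewrite -mulN1r -wdotZr//.
by congr wdot; apply/funext => z; rewrite scaleN1r.
Qed.

Lemma wdotBr k l (mu : R) (M : 'M[R]_(k, l)) X Y Z : 0 <= mu ->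
  inL2 X -> inL2 Y -> inL2 Z ->
  wdot mu M X (Y \- Z) = wdot mu M X Y - wdot mu M X Z.
Proof.
move=> mu0 hX hY hZ; rewrite -wdotNr// -wdotDr//; exact: inL2N.
Qed.

Lemma wdotC k l (mu : R) (M : 'M[R]_(k, l)) X Y :
  wdot mu M X Y = wdot mu M^T Y X.
Proof. by apply: eq_wdot => z; exact: mxformC. Qed.

Lemma wdotDl k l (mu : R) (M : 'M[R]_(k, l)) X Y Z :
  0 <= mu -> inL2 X -> inL2 Y -> inL2 Z ->
  wdot mu M (X \+ Y) Z = wdot mu M X Z + wdot mu M Y Z.
Proof. by move=> *; rewrite wdotC wdotDr// -!wdotC. Qed.

Lemma wdotZl k l (mu : R) (M : 'M[R]_(k, l)) X Y c :
  0 <= mu -> inL2 X -> inL2 Y ->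
  wdot mu M (fun z => c *: X z) Y = c * wdot mu M X Y.
Proof. by move=> *; rewrite wdotC wdotZr// -wdotC. Qed.

Lemma wdotDm k l (mu : R) (M M' : 'M[R]_(k, l)) X Y :
  0 <= mu -> inL2 X -> inL2 Y ->
  wdot mu (M + M') X Y = wdot mu M X Y + wdot mu M' X Y.
Proof.
move=> mu0 hX hY; rewrite -RintegralD//; try exact: int01_wdot.
by apply: eq_Rintegral => z _; rewrite mulmxDr mulmxDl mxE mulrDr.
Qed.

Lemma wdotZm k l (mu : R) (M : 'M[R]_(k, l)) X Y c :
  0 <= mu -> inL2 X -> inL2 Y ->
  wdot mu (c *: M) X Y = c * wdot mu M X Y.
Proof.
move=> mu0 hX hY; rewrite -wdotZr//; apply: eq_wdot => z.
by rewrite -!scalemxAr -scalemxAl.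
Qed.

Lemma wdotMr k l l' (mu : R) (M : 'M[R]_(k, l)) (A : 'M[R]_(l, l')) X Y :
  wdot mu M X (fun z => A *m Y z) = wdot mu (M *m A) X Y.
Proof. by apply: eq_wdot => z; rewrite !mulmxA. Qed.

(** Needed to replace an element of the Sobolev space by its continuous
representative, and the Euler increment by the right-hand side of the equation. *)
Lemma ae_wdot k l (mu : R) (M : 'M[R]_(k, l)) X Y X' Y' : 0 <= mu ->
  inL2 X -> inL2 Y -> inL2 X' -> inL2 Y' -> eqL2 X X' -> eqL2 Y Y' ->
  wdot mu M X Y = wdot mu M X' Y'.
Proof.
move=> mu0 hX hY hX' hY' XX' YY'; congr fine.
apply: ae_eq_integral => //.
- have /integrableP[] := int01_wdot M mu0 hX hY; exact.
- have /integrableP[] := int01_wdot M mu0 hX' hY'; exact.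
- by apply: filterS2 XX' YY' => z h h' z01; rewrite h// h'.
Qed.

Lemma wdot_ge0 k (mu : R) (M : 'M[R]_k) X : psdmx M -> 0 <= wdot mu M X X.
Proof.
by move=> [_ h]; apply: Rintegral_ge0 => z _; rewrite mulr_ge0 ?expR_ge0.
Qed.

Lemma normL2_sqr k (X : R -> 'cV[R]_k) : normL2 X ^+ 2 = wdot 0 1%:M X X.
Proof.
rewrite sqr_sqrtr; last by apply: Rintegral_ge0 => z _; apply: sumr_ge0 => *; exact: sqr_ge0.
apply: eq_Rintegral => z _; rewrite mul0r oppr0 expR0 mul1r mulmx1 mxE.
by apply: eq_bigr => i _; rewrite mxE expr2.
Qed.

Lemma normL2_ge0 k (X : R -> 'cV[R]_k) : 0 <= normL2 X.
Proof. exact: sqrtr_ge0. Qed.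

(** The discriminant of a nonnegative quadratic, including the degenerate case
A = 0: there the polynomial is affine in s and a large s of the right sign
forces C = 0. *)
Lemma quadratic_ge0 (A B C : R) : 0 <= A ->
  (forall s, 0 <= s ^+ 2 * A + 2 * s * C + B) -> C ^+ 2 <= A * B.
Proof.
rewrite le_eqVlt => /predU1P[<- h|A0 h].
  have [->|C0] := eqVneq C 0; first by rewrite expr0n/= mul0r.
  have := h (- (B + 1) / (2 * C)).
  have -> : (- (B + 1) / (2 * C)) ^+ 2 * 0 + 2 * (- (B + 1) / (2 * C)) * C + B = -1.
    by field.
  by rewrite ler0N1.
have := h (- C / A).
have -> : (- C / A) ^+ 2 * A + 2 * (- C / A) * C + B = (A * B - C ^+ 2) / A.
  by field; rewrite gt_eqF.
by rewrite pmulr_lge0 ?invr_gt0// subr_ge0.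
Qed.

Lemma wdot_CS k (mu : R) (M : 'M[R]_k) X Y : 0 <= mu -> psdmx M ->
  inL2 X -> inL2 Y -> wdot mu M X Y ^+ 2 <= wdot mu M X X * wdot mu M Y Y.
Proof.
move=> mu0 [Ms Mp] hX hY.
have ge0 Z : 0 <= wdot mu M Z Z.
  by apply: Rintegral_ge0 => z _; rewrite mulr_ge0 ?expR_ge0.
apply: quadratic_ge0 => // s.
have hs := inL2Z s hX.
have := ge0 ((fun z => s *: X z) \+ Y).
rewrite wdotDl//; last exact: inL2D.
rewrite !wdotDr// !wdotZl// !wdotZr//.
by rewrite (wdotC mu M Y) Ms; lra.
Qed.

Lemma wdot1_le_normM k (X Y : R -> 'cV[R]_k) : inL2 X -> inL2 Y ->
  wdot 0 1%:M X Y <= normL2 X * normL2 Y.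
Proof.
move=> hX hY; rewrite (le_trans (ler_norm _))//.
rewrite -ler_sqr ?nnegrE ?mulr_ge0 ?normL2_ge0//.
by rewrite real_normK ?num_real// exprMn !normL2_sqr wdot_CS//; exact: psd1.
Qed.

Lemma normL2D k (X Y : R -> 'cV[R]_k) : inL2 X -> inL2 Y ->
  normL2 (X \+ Y) <= normL2 X + normL2 Y.
Proof.
move=> hX hY; rewrite -ler_sqr ?nnegrE ?addr_ge0 ?normL2_ge0//.
rewrite normL2_sqr wdotDl//; last exact: inL2D.
rewrite !wdotDr// -!normL2_sqr (wdotC 0 1%:M Y) trmx1.
by have := wdot1_le_normM hX hY; lra.
Qed.

Lemma normL2N k (X : R -> 'cV[R]_k) : inL2 X -> normL2 (fun z => - X z) = normL2 X.
Proof.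
move=> hX; apply/eqP; rewrite -(eqrXn2 (n := 2))// ?normL2_ge0//.
rewrite !normL2_sqr; apply/eqP; apply: eq_wdot => z.
by rewrite !mulmx1 mulmxN linearN mulNmx opprK.
Qed.

Lemma normL2_distC k (X Y : R -> 'cV[R]_k) : inL2 X -> inL2 Y ->
  normL2 (X \- Y) = normL2 (Y \- X).
Proof.
move=> hX hY; rewrite -normL2N; last exact: inL2B.
by congr normL2; apply/funext => z /=; rewrite opprB.
Qed.

Lemma normL2_tri k (X Y : R -> 'cV[R]_k) : inL2 X -> inL2 Y ->
  normL2 X <= normL2 Y + normL2 (X \- Y).
Proof.
move=> hX hY; have := normL2D hY (inL2B hX hY); congr (normL2 _ <= _).
by apply/funext => z /=; rewrite addrC subrK.
Qed.

Lemma wdot_le_norm k (mu c : R) (P : 'M[R]_k) X : 0 <= mu -> diag_pdmx P ->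
  (forall i, P i i <= c) -> inL2 X -> wdot mu P X X <= c * normL2 X ^+ 2.
Proof.
move=> mu0 [dP /pd_psd[_ pP]] hc hX; rewrite normL2_sqr -wdotZm//.
apply: le_Rintegral => //; try exact: int01_wdot.
move=> z /=; rewrite in_itv/= => /andP[z0 _].
rewrite mul0r oppr0 expR0 mul1r (@le_trans _ _ (bil P (X z) (X z)))//.
  by rewrite ler_piMl// expR_le1 oppr_le0 mulr_ge0// ltW.
rewrite -/(bil _ _ _) bilZm !bil_diag ?scalar_mx_is_diag//.
rewrite mulr_sumr; apply: ler_sum => i _.
by rewrite mxE eqxx mul1r ler_wpM2r// -expr2 sqr_ge0.
Qed.

(** On the unit interval the weight is at least e^(-mu). *)
Lemma norm_le_wdot k (mu c : R) (P : 'M[R]_k) X : 0 <= mu -> diag_pdmx P ->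
  0 <= c -> (forall i, c <= P i i) -> inL2 X ->
  expR (- mu) * c * normL2 X ^+ 2 <= wdot mu P X X.
Proof.
move=> mu0 [dP /pd_psd[_ pP]] c0 hc hX; rewrite normL2_sqr -mulrA -wdotZm// -wdotZm//.
apply: le_Rintegral => //; try exact: int01_wdot.
move=> z /=; rewrite in_itv/= => /andP[z0 z1].
rewrite mul0r oppr0 expR0 mul1r -!/(bil _ _ _) bilZm.
rewrite (@le_trans _ _ (expR (- mu) * bil P (X z) (X z)))//; last first.
  apply: ler_wpM2r; first exact: pP.
  by rewrite ler_expR lerN2 ler_piMr// ltW.
rewrite ler_wpM2l ?expR_ge0// bilZm !bil_diag ?scalar_mx_is_diag//.
rewrite mulr_sumr; apply: ler_sum => i _.
by rewrite mxE eqxx mul1r ler_wpM2r// -expr2 sqr_ge0.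
Qed.

Lemma wdot1_le_norm k (mu : R) (X : R -> 'cV[R]_k) : 0 <= mu -> inL2 X ->
  wdot mu 1%:M X X <= normL2 X ^+ 2.
Proof.
move=> mu0 hX; rewrite normL2_sqr; apply: le_Rintegral => //; try exact: int01_wdot.
move=> z /=; rewrite in_itv/= => /andP[z0 _].
rewrite mul0r oppr0 expR0 mul1r ler_piMl//; first by have [_] := @psd1 R k; apply.
by rewrite expR_le1 oppr_le0 mulr_ge0// ltW.
Qed.

Lemma wdot_le_normM k (mu c : R) (P : 'M[R]_k) X Y : 0 <= mu -> diag_pdmx P ->
  (forall i, P i i <= c) -> 0 <= c -> inL2 X -> inL2 Y ->
  `|wdot mu P X Y| <= c * (normL2 X * normL2 Y).
Proof.
move=> mu0 dP hc c0 hX hY.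
have pP : psdmx P by case: dP => _ /pd_psd.
have n0 := mulr_ge0 c0 (mulr_ge0 (normL2_ge0 X) (normL2_ge0 Y)).
rewrite -ler_sqr ?nnegrE// real_normK ?num_real//.
rewrite (le_trans (wdot_CS mu0 pP hX hY))//.
have -> : (c * (normL2 X * normL2 Y)) ^+ 2 =
  (c * normL2 X ^+ 2) * (c * normL2 Y ^+ 2) by ring.
by apply: ler_pM; [exact: wdot_ge0|exact: wdot_ge0|exact: wdot_le_norm..].
Qed.

(** The difference of the two sides is the energy of X - Y. For X, Y two
consecutive Euler iterates this replaces the chain rule for d/dt V. *)
Lemma wdot_increment k (mu : R) (M : 'M[R]_k) X Y : 0 <= mu -> psdmx M ->
  inL2 X -> inL2 Y ->
  wdot mu M X X - wdot mu M Y Y <= 2 * wdot mu M X (X \- Y).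
Proof.
move=> mu0 pM hX hY; have sM : M^T = M by case: pM.
have := wdot_ge0 mu (X \- Y) pM; have hXY := inL2B hX hY.
rewrite wdotBr// (wdotC mu M _ X) (wdotC mu M _ Y) sM !wdotBr//.
by rewrite (wdotC mu M Y X) sM; lra.
Qed.

End weighted_forms.

(** * Primitives of integrable functions and the product rule *)

Section primitives.
Context {R : realType}.
Local Notation leb := (@lebesgue_measure R).

(** A relation between end points that chains along adjacent intervals and holds
on all short intervals around each point holds on the whole interval: the
supremum of the points reachable from a is reached, and cannot be below b. Here
it plays the part of uniform continuity in the estimates over a fine partition. *)
Lemma interval_induction (P : R -> R -> Prop) (a b : R) : a <= b ->
  (forall x y z, a <= x -> x <= y -> y <= z -> z <= b ->
     P x y -> P y z -> P x z) ->
  (forall c, a <= c <= b -> exists2 d : R, 0 < d & forall x y,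
     a <= x -> x <= y -> y <= b -> `|x - c| < d -> `|y - c| < d -> P x y) ->
  P a b.
Proof.
move=> ab Padd Ploc.
pose S := [set y | a <= y <= b /\ P a y].
have Sa : S a.
  split; first by rewrite lexx ab.
  have [|d d0 h] := Ploc a; first by rewrite lexx ab.
  by apply: h; rewrite // subrr normr0.
have Sb : ubound S b by move=> y [/andP[_ yb] _].
have supS : has_sup S by split; [exists a|exists b].
have sa : a <= sup S by apply: sup_upper_bound.
have sb : sup S <= b by apply: ge_sup => //; exists a.
have [d d0 h] := Ploc (sup S) (introT andP (conj sa sb)).
have [x [/andP[ax xb] Px] dx] := sup_adherent d0 supS.
have xs : x <= sup S by apply: sup_upper_bound => //; split => //; apply/andP.
pose y := Num.min b (sup S + d / 2).
have [yb ys] : y <= b /\ y <= sup S + d / 2 by split; rewrite ge_min lexx ?orbT.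
have sy : sup S <= y by rewrite le_min sb/= lerDl; lra.
have Sy : S y.
  split; first by apply/andP; split; lra.
  apply: (Padd a x y) => //; first by lra.
  apply: h => //; first by lra.
    by rewrite ler0_norm; lra.
  by rewrite ger0_norm; lra.
have ysup : y <= sup S by apply: sup_upper_bound.
suff -> : b = y by case: Sy.
by move: ysup; rewrite /y; case: (leP b (sup S + d / 2)) => // _; lra.
Qed.

Lemma Rintegral_oo_split (f : R -> R) (x y z : R) : int01 f ->
  0 <= x -> x <= y -> y <= z -> z <= 1 ->
  \int[leb]_(t in `]x, z[) f t =
  \int[leb]_(t in `]x, y[) f t + \int[leb]_(t in `]y, z[) f t.
Proof.
move=> hf x0; rewrite le_eqVlt => /predU1P[->|xy].
  by move=> _ _; rewrite [in X in X + _]set_itv_ge ?bnd_simp ?ltxx// Rintegral_set0 add0r.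
rewrite le_eqVlt => /predU1P[->|yz] z1.
  by rewrite [in X in _ + X]set_itv_ge ?bnd_simp ?ltxx// Rintegral_set0 addr0.
have h := Rintegral_itvB (x := y) (int01S x0 z1 hf).
have {}h := h ltac:(by rewrite bnd_simp ltW) ltac:(by rewrite bnd_simp).
rewrite -Rintegral_itv_bndo_bndc in h; last by apply: int01S => //; lra.
by rewrite -h addrC subrK.
Qed.

(** a is absolutely continuous with almost everywhere derivative a', stated
through the integral. *)
Definition primitive (a a' : R -> R) := [/\ int01 a',
  {within `[0, 1], continuous a} &
  forall x y, 0 <= x -> x <= y -> y <= 1 ->
    a y - a x = \int[leb]_(z in `]x, y[) a' z].

Lemma measurable_within (a : R -> R) : {within `[0, 1], continuous a} ->
  measurable_fun (`[0, 1]%classic : set R) a.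
Proof. exact: subspace_continuous_measurable_fun. Qed.

Lemma within_bounded (a : R -> R) : {within `[0, 1], continuous a} ->
  exists M, forall z, 0 <= z <= 1 -> `|a z| <= M.
Proof.
move=> ca; have [c1 _ h1] := EVT_max ler01 ca; have [c2 _ h2] := EVT_min ler01 ca.
exists (`|a c1| + `|a c2|) => z z01.
have := h1 z; have := h2 z; rewrite !in_itv/= => /(_ z01) + /(_ z01).
have := ler_norm (a c1); have := ler_norm (- a c2); rewrite normrN.
have := normr_ge0 (a c1); have := normr_ge0 (a c2).
by rewrite ler_norml => *; apply/andP; split; lra.
Qed.

Lemma int01_within (a f : R -> R) : {within `[0, 1], continuous a} ->
  int01 f -> int01 (fun z => a z * f z).
Proof.
move=> ca hf; have [M hM] := within_bounded ca.
have := hf => /(int01Z M) => h; apply: le_integrable h => //.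
  apply/measurable_EFinP; apply: measurable_funM.
    apply: measurable_funS (measurable_within ca) => //.
    exact: subset_itv_oo_cc.
  by have /integrableP[/measurable_EFinP] := hf.
move=> z /=; rewrite in_itv/= => /andP[z0 z1]; rewrite lee_fin !normrM.
have h : `|a z| <= M by apply: hM; apply/andP; split; lra.
by rewrite ler_wpM2r// (le_trans h)// ler_norm.
Qed.

Lemma within_cvg_dist (a : R -> R) c e : {within `[0, 1], continuous a} ->
  0 <= c <= 1 -> 0 < e -> exists2 d : R, 0 < d &
    forall x, 0 <= x <= 1 -> `|x - c| < d -> `|a x - a c| < e.
Proof.
move=> ca c01 e0; have c01' : `[0, 1]%classic c by rewrite /= in_itv.
have /subspace_continuousP /(_ c c01') /cvgrPdist_lt/(_ e e0) := ca.
rewrite near_withinE => /nbhs_ballP[d d0 h].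
exists d => // x x01 xc; rewrite distrC; apply: h => //.
by rewrite /ball/= distrC.
Qed.

Lemma within_mul (a b : R -> R) (A : set R) : {within A, continuous a} ->
  {within A, continuous b} -> {within A, continuous (fun z => a z * b z)}.
Proof. by move=> ca cb z; apply: cvgM; [exact: ca|exact: cb]. Qed.

Lemma le_Rint01 (f g : R -> R) x y : 0 <= x -> y <= 1 -> int01 f -> int01 g ->
  (forall z, x < z < y -> f z <= g z) ->
  \int[leb]_(z in `]x, y[) f z <= \int[leb]_(z in `]x, y[) g z.
Proof.
move=> x0 y1 hf hg h; apply: le_Rintegral => //; try exact: int01S.
all: by move=> z /=; rewrite in_itv/= => /h.
Qed.

Lemma dist_between (c d s z t : R) : s <= z -> z <= t ->
  `|s - c| < d -> `|t - c| < d -> `|z - c| < d.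
Proof.
by move=> ? ?; rewrite !ltr_norml => /andP[? ?] /andP[? ?]; apply/andP; split; lra.
Qed.

Lemma dist_half (e p q r : R) :
  `|p - r| < e / 2 -> `|q - r| < e / 2 -> `|p - q| <= e.
Proof.
rewrite !ltr_norml => /andP[? ?] /andP[? ?].
by rewrite ler_norml; apply/andP; split; lra.
Qed.

Lemma small_multiple (i e : R) : 0 <= i -> 0 < e ->
  exists2 eta : R, 0 < eta & eta * i <= e.
Proof.
move=> i0 e0; exists (e / (i + 1)); first by rewrite divr_gt0//; lra.
by rewrite mulrAC ler_pdivrMr; [rewrite ler_pM2l//; lra|lra].
Qed.

(** For the exact increment,
a(t) b(t) - a(s) b(s) = a(t) ∫ b' + b(s) ∫ a', so its distance to the integral of
a b' + b a' over ]s, t[ is at most the oscillation of a and b on [s, t] times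
∫ (|a'| + |b'|). Such bounds add up over adjacent intervals, and the oscillation
is arbitrarily small on short ones. *)
Lemma primitive_mul (a a' b b' : R -> R) : primitive a a' -> primitive b b' ->
  primitive (fun z => a z * b z) (fun z => a z * b' z + b z * a' z).
Proof.
move=> [ia ca ha] [ib cb hb].
have iab : int01 (fun z => a z * b' z + b z * a' z).
  by apply: int01D; apply: int01_within.
split; [exact: iab|exact: within_mul|move=> x y x0 xy y1].
have [k kE] : {k : R -> R | forall z, k z = `|a' z| + `|b' z|}.
  by exists (fun z => `|a' z| + `|b' z|).
have ik : int01 k by rewrite (funext kE); apply: int01D; exact: int01_abs.
apply/eqP; rewrite -subr_eq0 -normr_le0; apply/ler_addgt0Pr => e e0; rewrite add0r.
have k0 : 0 <= \int[leb]_(z in `]x, y[) k z.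
  by apply: Rintegral_ge0 => z _; rewrite kE addr_ge0.
(* oscillation that keeps the total error below e *)
have [eta eta0 etaI] := small_multiple k0 e0.
apply: (le_trans _ etaI).
apply: (@interval_induction (fun x y =>
  `|a y * b y - a x * b x - \int[leb]_(z in `]x, y[) (a z * b' z + b z * a' z)| <=
  eta * \int[leb]_(z in `]x, y[) k z) x y xy).
  move=> s t u xs st tu uy h1 h2.
  have s0 := le_trans x0 xs; have u1 := le_trans uy y1.
  rewrite (@Rintegral_oo_split _ s t u iab)// (@Rintegral_oo_split _ s t u ik)//.
  rewrite mulrDr (le_trans _ (lerD h1 h2))// (le_trans _ (ler_normD _ _))//.
  by rewrite le_eqVlt; apply/orP; left; apply/eqP; congr `|_|; ring.
move=> c /andP[xc cy].
have c01 : 0 <= c <= 1 by rewrite (le_trans x0 xc) (le_trans cy y1).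
have e2 : 0 < eta / 2 by rewrite divr_gt0.
have [d1 d10 h1] := within_cvg_dist ca c01 e2.
have [d2 d20 h2] := within_cvg_dist cb c01 e2.
exists (Num.min d1 d2); first by rewrite lt_min d10.
move=> s t xs st ty; rewrite !lt_min => /andP[sc1 sc2] /andP[tc1 tc2].
have s0 : 0 <= s := le_trans x0 xs.
have t1 : t <= 1 := le_trans ty y1.
(* the increment of the product, with a(t) and b(s) frozen *)
have -> : a t * b t - a s * b s - \int[leb]_(z in `]s, t[) (a z * b' z + b z * a' z)
  = \int[leb]_(z in `]s, t[) ((a t - a z) * b' z + (b s - b z) * a' z).
  have -> : a t * b t - a s * b s = a t * (b t - b s) + b s * (a t - a s) by ring.
  rewrite ha// hb// -!RintegralZl//; try exact: int01S.
  rewrite -RintegralD//; try by apply: int01S => //; apply: int01Z.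
  rewrite -RintegralB//; last by apply: int01S.
    by apply: eq_Rintegral => z _; ring.
  by apply: int01S => //; apply: int01D; apply: int01Z.
have ii : int01 (fun z => (a t - a z) * b' z + (b s - b z) * a' z).
  apply: int01D; apply: int01_within => // z; apply: cvgB;
    by [exact: cvg_cst|exact: ca|exact: cb].
rewrite (le_trans (le_normr_Rintegral _ _))//; first exact: int01S.
rewrite -RintegralZl//; last exact: int01S.
apply: le_Rint01 => //; [exact: int01_abs|exact: int01Z|].
move=> z /andP[sz zt].
have z01 : 0 <= z <= 1 by rewrite !ltW ?(le_lt_trans s0 sz) ?(lt_le_trans zt t1).
have t01 : 0 <= t <= 1 by rewrite (le_trans s0 st) t1.
have s01 : 0 <= s <= 1 by rewrite (le_trans st t1) s0.
have osc d : `|s - c| < d -> `|t - c| < d -> `|z - c| < d.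
  by apply: dist_between; exact: ltW.
have azt : `|a t - a z| <= eta by apply: (@dist_half _ _ _ (a c)); apply: h1 => //; exact: osc.
have bzs : `|b s - b z| <= eta by apply: (@dist_half _ _ _ (b c)); apply: h2 => //; exact: osc.
rewrite (le_trans (ler_normD _ _))// !normrM kE mulrDr addrC.
by apply: lerD; rewrite ler_wpM2r.
Qed.

Lemma primitive_C1 (f f' : R -> R) : (forall z : R, is_derive z 1 f (f' z)) ->
  continuous f' -> primitive f f'.
Proof.
move=> df cf'.
have cf : continuous f.
  by move=> z; apply/differentiable_continuous/derivable1_diffP; case: (df z).
have int x y : leb.-integrable `[x, y] (EFin \o f').
  apply: continuous_compact_integrable; first exact: segment_compact.
  exact: continuous_subspaceT.
split; first by apply: integrableS (int 0 1) => //; exact: subset_itv_oo_cc.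
  exact: continuous_subspaceT.
move=> x y x0; rewrite le_eqVlt => /predU1P[<-|xy] y1.
  by rewrite subrr set_itv_ge ?bnd_simp ?ltxx// Rintegral_set0.
rewrite /Rintegral -(@integral_itv_bndoo _ x y _ true false); last first.
  have /integrableP[+ _] := int x y; apply: measurable_funS => //.
  exact: subset_itv_oo_cc.
rewrite (@continuous_FTC2 _ f' f)//.
- exact: continuous_subspaceT.
- split; first by move=> z _; case: (df z).
  + exact/cvg_at_right_filter/cf.
  + exact/cvg_at_left_filter/cf.
- by move=> z _; rewrite derive1E; have [_ ->] := df z.
Qed.

Lemma primitive0 : primitive (fun=> 0 : R) (fun=> 0).
Proof.
have [i0 _ h] : primitive (cst (0 : R)) (cst 0).
  by apply: primitive_C1 => z; exact: cvg_cst.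
by split=> // z; exact: cvg_cst.
Qed.

Lemma primitiveD (a a' b b' : R -> R) : primitive a a' -> primitive b b' ->
  primitive (fun z => a z + b z) (fun z => a' z + b' z).
Proof.
move=> [ia ca ha] [ib cb hb]; split.
- exact: int01D.
- by move=> z; apply: cvgD; [exact: ca|exact: cb].
- move=> x y x0 xy y1; rewrite RintegralD//; try exact: int01S.
  by rewrite -ha// -hb//; ring.
Qed.

Lemma primitiveZ (c : R) (a a' : R -> R) : primitive a a' ->
  primitive (fun z => c * a z) (fun z => c * a' z).
Proof.
move=> [ia ca ha]; split.
- exact: int01Z.
- by move=> z; apply: cvgM; [exact: cvg_cst|exact: ca].
- move=> x y x0 xy y1; rewrite RintegralZl//; last exact: int01S.
  by rewrite -ha//; ring.
Qed.

Lemma primitive_sum I (s : seq I) (a a' : I -> R -> R) :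
  (forall i, primitive (a i) (a' i)) ->
  primitive (fun z => \sum_(i <- s) a i z) (fun z => \sum_(i <- s) a' i z).
Proof.
move=> h; elim: s => [|i s ih].
  under eq_fun do rewrite big_nil; under [X in primitive _ X]eq_fun do rewrite big_nil.
  exact: primitive0.
under eq_fun do rewrite big_cons; under [X in primitive _ X]eq_fun do rewrite big_cons.
exact: primitiveD.
Qed.

Lemma scaleRE (a b : R) : a *: (b : R^o) = a * b.
Proof. by []. Qed.

Lemma is_derive_affine (c d z : R) : is_derive z 1 (fun z => c * z + d) c.
Proof.
have h : is_derive z 1 (fun z : R => c *: id z + cst d z) (c *: 1 + 0).
  by apply: is_deriveD.
by apply: is_derive_eq h _; rewrite addr0 /GRing.scale/= mulr1.
Qed.

Lemma primitive_exp (mu : R) :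
  primitive (fun z => expR (- (mu * z))) (fun z => - mu * expR (- (mu * z))).
Proof.
have ce : continuous (fun z : R => expR (- (mu * z))).
  move=> z; apply: (@continuous_comp _ _ _ (fun z => - (mu * z)) expR).
    by apply: cvgN; apply: cvgM; [exact: cvg_cst|exact: cvg_id].
  exact: continuous_expR.
apply: primitive_C1 => z; last first.
  by apply: cvgM; [exact: cvg_cst|exact: ce].
have h := is_derive_affine (- mu) 0 z.
have h2 := @is_derive1_comp _ expR _ z _ _ (is_derive_expR (- mu * z + 0)) h.
have -> : (fun z => expR (- (mu * z))) = expR \o (fun z => - mu * z + 0).
  by apply/funext => y /=; rewrite addr0 mulNr.
by apply: is_derive_eq h2 _; rewrite addr0 mulNr mulrC.
Qed.

End primitives.

(** * Smooth plateau functions *)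

Section smooth_step.
Context {R : realType}.
Local Notation leb := (@lebesgue_measure R).

(** The simplest C^1 function that vanishes on a half-line; its second differences
give a C^1 step with an explicit derivative. *)
Definition pos_sqr (r : R) := Num.max r 0 ^+ 2.

(** The derivative 2 max(r, 0) is 2-Lipschitz, hence this second-order bound
without any case distinction at r = 0. *)
Lemma pos_sqr_taylor (r h : R) :
  `|pos_sqr (r + h) - pos_sqr r - 2 * Num.max r 0 * h| <= h ^+ 2.
Proof.
by rewrite /pos_sqr ler_norml; case: (leP r 0) => hr; case: (leP (r + h) 0) => hs;
  apply/andP; split; nra.
Qed.

Lemma pos_sqr_quotient_cvg (r : R) :
  h^-1 *: (pos_sqr (h *: (1 : R) + r) - pos_sqr r) @[h --> 0^'] -->
    (2 * Num.max r 0 : R).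
Proof.
apply/cvgrPdist_le => e e0; near=> h.
have h0 : h != 0 by near: h; exact: nbhs_dnbhs_neq.
have he : `|h| <= e.
  by near: h; apply: dnbhs0_le.
rewrite (le_trans _ he)// distrC.
rewrite -(ler_pM2l (x := `|h|)) ?normr_gt0// -normrM -expr2 real_normK ?num_real//.
have := pos_sqr_taylor r h; congr (`|_| <= _).
by rewrite /GRing.scale/= mulr1 (addrC h) mulrBr mulrA mulfV// mul1r; ring.
Unshelve. all: by end_near. Qed.

Lemma is_derive_pos_sqr (r : R) : is_derive r 1 pos_sqr (2 * Num.max r 0).
Proof.
have h := @pos_sqr_quotient_cvg r.
apply: DeriveDef; first by apply/cvg_ex; exists (2 * Num.max r 0).
exact: cvg_lim h.
Qed.

(** Rises from 0 to 1 on [1, 3]. The flat part on [0, 1] keeps the supports of the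
test functions [plateau] away from the end points of their interval, so that the
interval may touch the boundary of ]0, 1[. *)
Definition step (r : R) :=
  (pos_sqr (r - 1) - 2 * pos_sqr (r - 2) + pos_sqr (r - 3)) / 2.

Definition tent (r : R) :=
  Num.max (r - 1) 0 - 2 * Num.max (r - 2) 0 + Num.max (r - 3) 0.

Lemma is_derive_step (r : R) : is_derive r 1 step (tent r).
Proof.
have hp c : is_derive r 1 (fun r => pos_sqr (r - c)) (2 * Num.max (r - c) 0).
  rewrite (_ : (fun r => _) = pos_sqr \o (fun r => 1 * r - c)); last first.
    by apply/funext => z /=; rewrite mul1r.
  have h := is_derive_affine 1 (- c) r.
  have h' := is_derive_pos_sqr (1 * r - c).
  have h2 := @is_derive1_comp _ pos_sqr _ r _ _ h' h.
  by apply: is_derive_eq h2 _; rewrite mul1r mulr1.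
have h := is_deriveZ (2^-1 : R)
  (is_deriveD (is_deriveD (hp 1) (is_deriveZ (-2 : R) (hp 2))) (hp 3)).
have -> : step = fun z => 2^-1 *
    (pos_sqr (z - 1) + -2 * pos_sqr (z - 2) + pos_sqr (z - 3)).
  by apply/funext => z; rewrite /step; lra.
by apply: is_derive_eq h _; rewrite /tent !scaleRE; lra.
Qed.

Lemma continuous_tent : continuous tent.
Proof.
have hc (c : R) : continuous (fun r : R => Num.max (r - c) 0).
  move=> r; apply: (@continuous_max _ _ (fun r => r - c) (cst 0)); last exact: cvg_cst.
  by apply: cvgB; [exact: cvg_id|exact: cvg_cst].
move=> r; apply: cvgD; last exact: hc.
by apply: cvgB; [exact: hc|apply: cvgM; [exact: cvg_cst|exact: hc]].
Qed.

Lemma step_le1 (r : R) : r <= 1 -> step r = 0.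
Proof. by move=> h; rewrite /step /pos_sqr !max_r; [ring|lra..]. Qed.

Lemma step_ge3 (r : R) : 3 <= r -> step r = 1.
Proof. by move=> h; rewrite /step /pos_sqr !max_l; [field|lra..]. Qed.

Lemma tent_ge0 (r : R) : 0 <= tent r.
Proof.
by rewrite /tent; case: (leP (r - 1) 0); case: (leP (r - 2) 0);
  case: (leP (r - 3) 0) => *; lra.
Qed.

Lemma tent_neq0 (r : R) : tent r != 0 -> 1 < r < 3.
Proof.
apply: contraNT; rewrite negb_and -!leNgt => /orP[h|h]; apply/eqP.
  by rewrite /tent !max_r; [ring|lra..].
by rewrite /tent !max_l; [ring|lra..].
Qed.

Lemma step_bounds (r : R) : 0 <= step r <= 1.
Proof.
rewrite /step /pos_sqr; case: (leP (r - 1) 0) => h1; case: (leP (r - 2) 0) => h2;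
  case: (leP (r - 3) 0) => h3; apply/andP; split; nra.
Qed.

Lemma is_derive_step_affine (c d z : R) :
  is_derive z 1 (fun z => step (c * z + d)) (c * tent (c * z + d)).
Proof.
apply: is_derive_eq (@is_derive1_comp _ step _ z _ _
  (is_derive_step (c * z + d)) (is_derive_affine c d z)) _.
by rewrite mulrC.
Qed.

Lemma continuous_tent_affine (c d e : R) : continuous (fun z => e * tent (c * z + d)).
Proof.
move=> z; apply: cvgM; first exact: cvg_cst.
apply: (@continuous_comp _ _ _ (fun z => c * z + d) tent); last exact: continuous_tent.
by apply: cvgD; [apply: cvgM; [exact: cvg_cst|exact: cvg_id]|exact: cvg_cst].
Qed.

(** A C^1 approximation of the indicator of ]x, y[ from inside: it rises on
[x + 1/k, x + 3/k] and falls on [y - 3/k, y - 1/k]. *)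
Definition plateau (k x y z : R) := step (k * z + - (k * x)) + step (- k * z + k * y) - 1.

Definition plateau' (k x y z : R) :=
  k * tent (k * z + - (k * x)) - k * tent (- k * z + k * y).

Lemma is_derive_plateau (k x y z : R) : is_derive z 1 (plateau k x y) (plateau' k x y z).
Proof.
have h := is_deriveB (is_deriveD (is_derive_step_affine k (- (k * x)) z)
  (is_derive_step_affine (- k) (k * y) z)) (is_derive_cst (1 : R) z 1).
by apply: is_derive_eq h _; rewrite /plateau' subr0 mulNr.
Qed.

(** 4 <= k (y - x) ensures that the step at one end is completed where the other
one is still constant. *)
Lemma test_plateau (k x y : R) : 0 <= x -> y <= 1 -> 4 <= k * (y - x) -> 0 < k ->
  test_function (plateau k x y).
Proof.
move=> x0 y1 kxy k0.
have ik : 0 < k^-1 by rewrite invr_gt0.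
have ki : k * k^-1 = 1 by rewrite mulfV// gt_eqF.
split.
- by move=> z; case: (is_derive_plateau k x y z).
- have -> : derive1 (plateau k x y) = plateau' k x y.
    by apply/funext => z; rewrite derive1E; case: (is_derive_plateau k x y z).
  by move=> z; apply: cvgB; exact: continuous_tent_affine.
- exists (x + k^-1), (y - k^-1); split; [lra|lra|].
  move=> z; rewrite in_itv/= negb_and -!ltNge => /orP[h|h].
    by rewrite /plateau step_le1 ?step_ge3; [ring|nra..].
  by rewrite /plateau step_ge3 ?step_le1; [ring|nra..].
Qed.

Lemma plateau_le1 (k x y z : R) : `|plateau k x y z| <= 1.
Proof.
rewrite /plateau; have := step_bounds (k * z + - (k * x)).
have := step_bounds (- k * z + k * y).
by rewrite ler_norml => /andP[? ?] /andP[? ?]; apply/andP; split; lra.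
Qed.

Lemma plateau_in (k x y z : R) : 3 <= k * (z - x) -> 3 <= k * (y - z) ->
  plateau k x y z = 1.
Proof.
move=> ? ?; rewrite /plateau (step_ge3 (r := k * z + - (k * x))); last by lra.
by rewrite step_ge3; lra.
Qed.

Lemma plateau_left (k x y z : R) : 0 < k -> z <= x -> 3 <= k * (y - x) ->
  plateau k x y z = 0.
Proof.
move=> k0 zx ?; have : k * z <= k * x by rewrite ler_pM2l.
move=> ?; rewrite /plateau (step_le1 (r := k * z + - (k * x))); last by lra.
by rewrite step_ge3; lra.
Qed.

Lemma plateau_right (k x y z : R) : 0 < k -> y <= z -> 3 <= k * (y - x) ->
  plateau k x y z = 0.
Proof.
move=> k0 zx ?; have : k * y <= k * z by rewrite ler_pM2l.
move=> ?; rewrite /plateau (step_ge3 (r := k * z + - (k * x))); last by lra.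
by rewrite step_le1; lra.
Qed.

End smooth_step.

(** * Weak derivatives and primitives *)

Section weak_derivatives.
Context {R : realType}.
Local Notation leb := (@lebesgue_measure R).

(** An average of a against a density w concentrated where a is close to a(c). *)
Lemma mean_close (a w : R -> R) c e : {within `[0, 1], continuous a} ->
  int01 w -> (forall z, 0 <= w z) -> \int[leb]_(z in `]0, 1[) w z = 1 ->
  0 <= e -> (forall z, 0 < z < 1 -> w z != 0 -> `|a z - a c| <= e) ->
  `|\int[leb]_(z in `]0, 1[) (a z * w z) - a c| <= e.
Proof.
move=> ca iw w0 w1 e0 h.
have iaw : int01 (fun z => a z * w z) by exact: int01_within.
have -> : \int[leb]_(z in `]0, 1[) (a z * w z) - a c =
          \int[leb]_(z in `]0, 1[) ((a z - a c) * w z).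
  rewrite [X in _ - X](_ : _ = a c * \int[leb]_(z in `]0, 1[) w z); last by rewrite w1 mulr1.
  rewrite -RintegralZl// -RintegralB//; last exact: int01Z.
  by apply: eq_Rintegral => z _; rewrite mulrBl.
have id : int01 (fun z => (a z - a c) * w z).
  by apply: int01_within => // z; apply: cvgB; [exact: ca|exact: cvg_cst].
rewrite (le_trans (le_normr_Rintegral _ _))//.
rewrite [leRHS](_ : _ = e * \int[leb]_(z in `]0, 1[) w z); last by rewrite w1 mulr1.
rewrite -RintegralZl//.
apply: le_Rint01 => //; [exact: int01_abs|exact: int01Z|move=> z z01].
rewrite normrM [X in _ * X]ger0_norm//.
have [->|wz] := eqVneq (w z) 0; first by rewrite !mulr0.
by rewrite ler_wpM2r// h.
Qed.

(** The derivative of the rising flank is a density of mass 1 on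
[x + 1/k, x + 3/k], an approximation of the Dirac mass at x. *)
Lemma mean_tent_left (u : R -> R) x e : {within `[0, 1], continuous u} ->
  0 <= x < 1 -> 0 < e -> exists K : R, forall k, K <= k ->
  `|\int[leb]_(z in `]0, 1[) (u z * (k * tent (k * z + - (k * x)))) - u x| <= e.
Proof.
move=> cu /andP[x0 x1] e0.
have x01 : 0 <= x <= 1 by rewrite x0 ltW.
have [d d0 hd] := within_cvg_dist cu x01 e0.
exists (3 / d + 3 / (1 - x)) => k Kk.
have d3 : 0 < 3 / d by rewrite divr_gt0.
have x3 : 0 < 3 / (1 - x) by rewrite divr_gt0// subr_gt0.
have k0 : 0 < k by lra.
have kd : 3 <= k * d by rewrite -ler_pdivrMr//; lra.
have kx : 3 <= k * (1 - x) by rewrite -ler_pdivrMr ?subr_gt0//; lra.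
have [iw _ hw] := primitive_C1 (fun z => is_derive_step_affine k (- (k * x)) z)
  (@continuous_tent_affine _ k (- (k * x)) k).
apply: mean_close => //.
- by move=> z; rewrite mulr_ge0 ?tent_ge0// ltW.
- by rewrite -hw// step_ge3 ?step_le1; [ring|nra..].
- exact: ltW.
- move=> z /andP[z0 z1]; rewrite mulf_eq0 gt_eqF//= => /tent_neq0 /andP[h1 h3].
  apply/ltW/hd; first by rewrite !ltW.
  by rewrite ltr_norml; apply/andP; split; nra.
Qed.

Lemma mean_tent_right (u : R -> R) y e : {within `[0, 1], continuous u} ->
  0 < y <= 1 -> 0 < e -> exists K : R, forall k, K <= k ->
  `|\int[leb]_(z in `]0, 1[) (u z * (k * tent (- k * z + k * y))) - u y| <= e.
Proof.
move=> cu /andP[y0 y1] e0.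
have y01 : 0 <= y <= 1 by rewrite y1 ltW.
have [d d0 hd] := within_cvg_dist cu y01 e0.
exists (3 / d + 3 / y) => k Kk.
have d3 : 0 < 3 / d by rewrite divr_gt0.
have y3 : 0 < 3 / y by rewrite divr_gt0.
have k0 : 0 < k by lra.
have kd : 3 <= k * d by rewrite -ler_pdivrMr//; lra.
have ky : 3 <= k * y by rewrite -ler_pdivrMr//; lra.
have [iw _ hw] := primitive_C1 (fun z => is_derive_step_affine (- k) (k * y) z)
  (@continuous_tent_affine _ (- k) (k * y) (- k)).
have wE : (fun z => k * tent (- k * z + k * y)) =
          fun z => -1 * (- k * tent (- k * z + k * y)).
  by apply/funext => z; ring.
apply: mean_close => //.
- by rewrite wE; exact: int01Z.
- by move=> z; rewrite mulr_ge0 ?tent_ge0// ltW.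
- rewrite wE RintegralZl// -hw// step_le1 ?step_ge3; [ring|nra..].
- exact: ltW.
- move=> z /andP[z0 z1]; rewrite mulf_eq0 gt_eqF//= => /tent_neq0 /andP[h1 h3].
  apply/ltW/hd; first by rewrite !ltW.
  by rewrite ltr_norml; apply/andP; split; nra.
Qed.

Lemma plateau_cvg (x y z : R) (k : R^nat) : x < y -> k @ \oo --> +oo ->
  plateau (k n) x y z @[n --> \oo] --> (\1_(`]x, y[%classic : set R) z : R).
Proof.
move=> xy koo; apply/cvgrPdist_le => e e0.
have /cvgryPge kge := koo; have /cvgryPgt/(_ 0) kgt := koo.
have [|z_out] := boolP (z \in `]x, y[).
  move=> zin; rewrite indicE mem_set//=.
  move: zin; rewrite in_itv/= => /andP[xz zy].
  have h1 := kge (3 / (z - x)); have h2 := kge (3 / (y - z)).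
  near=> n.
  have k1 : 3 / (z - x) <= k n by near: n.
  have k2 : 3 / (y - z) <= k n by near: n.
  rewrite ler_pdivrMr ?subr_gt0// in k1; rewrite ler_pdivrMr ?subr_gt0// in k2.
  by rewrite plateau_in// subrr normr0 ltW.
rewrite indicE memNset//=; last by move=> h; rewrite h in z_out.
move: z_out; rewrite in_itv/= negb_and -!leNgt => /orP[zx|yz].
  have h1 := kge (3 / (y - x)); near=> n.
  have k1 : 3 / (y - x) <= k n by near: n.
  rewrite ler_pdivrMr ?subr_gt0// in k1.
  have k0 : 0 < k n by near: n.
  by rewrite plateau_left// subrr normr0 ltW.
have h1 := kge (3 / (y - x)); near=> n.
have k1 : 3 / (y - x) <= k n by near: n.
rewrite ler_pdivrMr ?subr_gt0// in k1.
have k0 : 0 < k n by near: n.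
by rewrite plateau_right// subrr normr0 ltW.
Unshelve. all: by end_near. Qed.

(** Dominated convergence, with dominating function |g|. *)
Lemma int_plateau_cvg (g : R -> R) (x y : R) (k : R^nat) : int01 g ->
  0 <= x -> x < y -> y <= 1 -> k @ \oo --> +oo ->
  \int[leb]_(z in `]0, 1[) (g z * plateau (k n) x y z) @[n --> \oo] -->
  \int[leb]_(z in `]x, y[) g z.
Proof.
move=> ig x0 xy y1 koo.
have mg : measurable_fun (`]0, 1[%classic : set R) g.
  by have /integrableP[/measurable_EFinP] := ig.
have mb n : measurable_fun (`]0, 1[%classic : set R) (plateau (k n) x y).
  have cb : continuous (plateau (k n) x y).
    move=> z; apply/differentiable_continuous/derivable1_diffP.
    by case: (is_derive_plateau (k n) x y z).
  by apply: measurable_funTS; exact: continuous_measurable_fun.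
have mi : measurable_fun (`]0, 1[%classic : set R) (\1_(`]x, y[%classic : set R) : R -> R).
  exact: measurable_indic.
have [| | | | |h1 _ h2] := @dominated_convergence _ _ _ leb `]0, 1[%classic
  (measurable_itv _) (fun n z => (g z * plateau (k n) x y z)%:E)
  (fun z => (g z * \1_(`]x, y[%classic : set R) z)%:E) (fun z => `|g z|%:E).
- by move=> n; apply/measurable_EFinP; apply: measurable_funM => //; exact: mb.
- by apply/measurable_EFinP; apply: measurable_funM => //; exact: mi.
- apply: aeW => z _; apply/cvg_EFin; first exact: nearW.
  by apply: cvgM; [exact: cvg_cst|exact: plateau_cvg].
- exact: int01_abs.
- apply: aeW => z n _; rewrite lee_fin normrM ler_piMr//; exact: plateau_le1.
have -> : \int[leb]_(z in `]x, y[) g z =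
  \int[leb]_(z in `]0, 1[) (g z * \1_(`]x, y[%classic : set R) z).
  have sub : `]x, y[ `<=` (`]0, 1[%classic : set R).
    by apply: subset_itv; rewrite bnd_simp.
  rewrite -[in LHS](setIidr sub) Rintegral_mkcondr.
  by apply: eq_Rintegral => z _; rewrite patchE indicE; case: ifP => _; rewrite ?mulr1 ?mulr0.
apply: fine_cvg; rewrite fineK//.
exact: integrable_fin_num.
Qed.

(** Tested against the plateau on ]x, y[, the left side of the weak formulation
tends to u(x) - u(y) and the right side to - ∫_x^y g. *)
Lemma weak_derivative_primitive (u g : R -> R) :
  {within `[0, 1], continuous u} -> int01 g ->
  (forall phi, test_function phi ->
    \int[leb]_(z in `]0, 1[) (u z * derive1 phi z) =
    - \int[leb]_(z in `]0, 1[) (g z * phi z)) ->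
  primitive u g.
Proof.
move=> cu ig hw; split=> // x y x0; rewrite le_eqVlt => /predU1P[<-|xy] y1.
  by rewrite subrr set_itv_ge ?bnd_simp ?ltxx// Rintegral_set0.
have yx : 0 < y - x by rewrite subr_gt0.
(* slopes at least 4 / (y - x), as required by test_plateau *)
pose k n : R := 4 / (y - x) + n%:R.
have koo : k @ \oo --> +oo.
  apply/cvgryPge => r; near=> n; rewrite /k.
  have : r <= n%:R by near: n; exact: nbhs_infty_ger.
  by have : 0 < 4 / (y - x) by [rewrite divr_gt0]; move=> ? ?; lra.
have k0 n : 0 < k n by rewrite ltr_pwDl// divr_gt0.
have lim1 : \int[leb]_(z in `]0, 1[) (u z * plateau' (k n) x y z) @[n --> \oo] -->
    u x - u y.
  apply/cvgrPdist_le => e e0; have e2 : 0 < e / 2 by rewrite divr_gt0.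
  have [|K1 h1] := mean_tent_left cu _ e2 (x := x).
    by rewrite x0 (lt_le_trans xy).
  have [|K2 h2] := mean_tent_right cu _ e2 (y := y).
    by rewrite y1 (le_lt_trans x0).
  have /cvgryPge kge := koo; have hk1 := kge K1; have hk2 := kge K2.
  near=> n.
  have n1 : K1 <= k n by near: n.
  have n2 : K2 <= k n by near: n.
  have [iw1 _ _] := primitive_C1 (fun z => is_derive_step_affine (k n) (- (k n * x)) z)
    (@continuous_tent_affine _ (k n) (- (k n * x)) (k n)).
  have [iw2 _ _] := primitive_C1 (fun z => is_derive_step_affine (- k n) (k n * y) z)
    (@continuous_tent_affine _ (- k n) (k n * y) (- k n)).
  have -> : \int[leb]_(z in `]0, 1[) (u z * plateau' (k n) x y z) =
    \int[leb]_(z in `]0, 1[) (u z * (k n * tent (k n * z + - (k n * x)))) -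
    \int[leb]_(z in `]0, 1[) (u z * (k n * tent (- k n * z + k n * y))).
    rewrite -RintegralB//; first by apply: eq_Rintegral => z _; rewrite mulrBr.
    - exact: int01_within.
    - apply: int01_within => //.
      rewrite (_ : (fun z => _) = fun z => -1 * (- k n * tent (- k n * z + k n * y))).
        exact: int01Z.
      by apply/funext => z; ring.
  have := h1 _ n1; have := h2 _ n2; move: (\int[leb]_(z in _) _) => I2.
  move: (\int[leb]_(z in _) _) => I1.
  by rewrite !ler_norml => /andP[? ?] /andP[? ?]; apply/andP; split; lra.
have lim2 := int_plateau_cvg ig x0 xy y1 koo.
have E n : \int[leb]_(z in `]0, 1[) (u z * plateau' (k n) x y z) =
    - \int[leb]_(z in `]0, 1[) (g z * plateau (k n) x y z).
  rewrite -hw.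
    apply: eq_Rintegral => z _; congr (_ * _).
    by rewrite derive1E; case: (is_derive_plateau (k n) x y z).
  apply: test_plateau => //; rewrite -ler_pdivrMr// /k lerDl; exact: ler0n.
have lim3 : \int[leb]_(z in `]0, 1[) (u z * plateau' (k n) x y z) @[n --> \oo] -->
    - \int[leb]_(z in `]x, y[) g z.
  by rewrite (funext E); apply: cvgN.
have h := cvg_unique (@norm_hausdorff _ _) lim1 lim3.
by rewrite -[LHS]opprB h opprK.
Unshelve. all: by end_near. Qed.

Lemma H1_primitive k (X G Xc : R -> 'cV[R]_k) i :
  inH1_with X G -> continuous_repr X Xc ->
  primitive (fun z => Xc z i 0) (fun z => G z i 0).
Proof.
move=> [hX hG hw] [XXc cXc]; apply: weak_derivative_primitive => //.
  exact: inL2_int01.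
move=> phi hphi; rewrite -hw//; have [_ cphi _] := hphi.
have mphi : measurable_fun (`]0, 1[%classic : set R) (derive1 phi).
  by apply: measurable_funTS; exact: continuous_measurable_fun.
(* X and its continuous representative have the same weak derivative *)
congr fine; apply: ae_eq_integral => //.
- apply/measurable_EFinP; apply: measurable_funM => //.
  apply: measurable_funS (measurable_within (cXc i)) => //.
  exact: subset_itv_oo_cc.
- by apply/measurable_EFinP; apply: measurable_funM => //; exact: inL2_comp.
- by apply: filterS XXc => z h z01; rewrite h.
Qed.

Lemma within_inL2 k (X : R -> 'cV[R]_k) :
  (forall i, {within `[0, 1], continuous (fun z => X z i 0)}) -> inL2 X.
Proof.
move=> cX; apply/inL2P => i; split.
  apply: measurable_funS (measurable_within (cX i)) => //.
  exact: subset_itv_oo_cc.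
rewrite (_ : (fun z => _) = fun z => X z i 0 * (X z i 0 * 1)).
  by do 2! apply: int01_within => //; exact: int01_cst.
by apply/funext => z; rewrite mulr1 expr2.
Qed.

(** The fundamental theorem of calculus for e^(-mu z) X^T M X. *)
Lemma wdot_by_parts k (mu : R) (M : 'M[R]_k) (X G : R -> 'cV[R]_k) : 0 <= mu ->
  inL2 G -> (forall i, primitive (fun z => X z i 0) (fun z => G z i 0)) ->
  expR (- mu) * ((X 1)^T *m M *m X 1) 0 0 - ((X 0)^T *m M *m X 0) 0 0 =
  wdot mu M X G + wdot mu M G X - mu * wdot mu M X X.
Proof.
move=> mu0 hG hX.
have cX i : {within `[0, 1], continuous (fun z => X z i 0)} by case: (hX i).
have lX := within_inL2 cX.
pose a z := expR (- (mu * z)) * ((X z)^T *m M *m X z) 0 0.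
pose a' z := expR (- (mu * z)) *
  (((X z)^T *m M *m G z) 0 0 + ((G z)^T *m M *m X z) 0 0 - mu * ((X z)^T *m M *m X z) 0 0).
have [_ _ h] : primitive a a'.
  have h := primitive_sum (index_enum 'I_k) (fun i =>
    primitive_sum (index_enum 'I_k) (fun j => primitiveZ (M i j)
      (primitive_mul (primitive_exp mu) (primitive_mul (hX i) (hX j))))).
  congr primitive: h; apply/funext => z.
    rewrite /a mxform big_distrr/=; apply: eq_bigr => i _.
    by rewrite big_distrr/=; apply: eq_bigr => j _; ring.
  rewrite /a' !mxform mulrBr mulrDr 4!big_distrr/= -big_split/= -sumrB.
  apply: eq_bigr => i _; rewrite 4!big_distrr/= -big_split/= -sumrB.
  by apply: eq_bigr => j _; ring.
have := h 0 1 (lexx 0) ler01 (lexx 1).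
rewrite /a mulr1 mulr0 oppr0 expR0 mul1r => ->.
have i1 := int01_wdot M mu0 lX hG; have i2 := int01_wdot M mu0 hG lX.
have i3 := int01_wdot M mu0 lX lX.
rewrite -RintegralZl// -RintegralD// -RintegralB//; last exact: int01Z.
  by apply: eq_Rintegral => z _; rewrite /a'; ring.
exact: int01D.
Qed.

End weak_derivatives.

(** * Dissipation of one implicit Euler step *)

Section dissipation.
Context {R : realType}.
Local Notation leb := (@lebesgue_measure R).

(** sigma(u) lies between 0 and u, so that sigma(u) - u and sigma(u) have opposite
signs. *)
Lemma deadzone_sector (ubar u : R) : 0 < ubar ->
  (Num.min `|u| ubar * Num.sg u - u) * (Num.min `|u| ubar * Num.sg u) <= 0.
Proof.
move=> h; have [->|u0|u0] := sgrP u; first by rewrite mulr0 mulr0.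
- by case: (leP u ubar) => *; nra.
- by case: (leP (- u) ubar) => *; nra.
Qed.

(** The quadratic form of the matrix inequality at (x, phi) equals
x0^T Q x0 - rho x^T Q x - 2 phi^T T (phi + K x) with Q = P Lambda, and
phi + K x = sigma(K x), so that the last term is nonnegative by
[deadzone_sector], T being diagonal. *)
Lemma boundary_dissipation n m (P Lambda Hcl : 'M[R]_n) (B : 'M[R]_(n, m))
    (K : 'M[R]_(m, n)) (T : 'M[R]_m) (ubar : 'cV[R]_m) (rho : R) (x x0 : 'cV[R]_n) :
  symmetric_mx (P *m Lambda) -> diag_pdmx T -> (forall i, 0 < ubar i 0) ->
  nsdmx (block_mx
      (Hcl^T *m P *m Lambda *m Hcl - rho *: (P *m Lambda))
      (Hcl^T *m P *m Lambda *m B - K^T *m T)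
      (Hcl^T *m P *m Lambda *m B - K^T *m T)^T
      (B^T *m P *m Lambda *m B - 2 *: T)) ->
  x0 = Hcl *m x + B *m deadzone ubar (K *m x) ->
  bil (P *m Lambda) x0 x0 <= rho * bil (P *m Lambda) x x.
Proof.
move=> sQ dT hu [_ h]; set phi := deadzone _ _ => ->.
have := h (col_mx x phi); rewrite -/(bil _ _ _) bil_block.
rewrite -!mulmxA !(mulmxA P).
move: (P *m Lambda) sQ => Q sQ.
rewrite -[bil (_^T) phi x]bilC !bilDm !bilNm !bilZm !bilMl !bilMr => hle.
rewrite bilDl !bilDr [bil Q (B *m phi) _]bilC sQ.
have sT : bil T (K *m x) phi = bil T phi (K *m x).
  by rewrite bilC; case: dT => _ [-> _].
have : bil T phi (phi + K *m x) <= 0.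
  rewrite bil_diag; last by case: dT.
  apply: sumr_le0 => i _; rewrite pmulr_rle0; last exact: diag_entry_gt0.
  by rewrite /phi /deadzone subrK !mxE; have := deadzone_sector ((K *m x) i 0) (hu i); rewrite !mxE.
rewrite bilDr; move: hle sT.
by move: (bil T _ _) (bil T _ _) (bil T _ _) => *; lra.
Qed.

(** Integration by parts against the continuous representative, whose boundary
term has a sign by [boundary_dissipation]. *)
Lemma transport_dissipation n m (Lambda Hcl P : 'M[R]_n) (B : 'M[R]_(n, m))
  (K : 'M[R]_(m, n)) (T : 'M[R]_m) (ubar : 'cV[R]_m) (mu : R)
  (W G Wc : R -> 'cV[R]_n) : 0 <= mu ->
  symmetric_mx (P *m Lambda) -> diag_pdmx T -> (forall i, 0 < ubar i 0) ->
  nsdmx (block_mx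
      (Hcl^T *m P *m Lambda *m Hcl - expR (- mu) *: (P *m Lambda))
      (Hcl^T *m P *m Lambda *m B - K^T *m T)
      (Hcl^T *m P *m Lambda *m B - K^T *m T)^T
      (B^T *m P *m Lambda *m B - 2 *: T)) ->
  inH1_with W G -> continuous_repr W Wc ->
  Wc 0 = Hcl *m Wc 1 + B *m deadzone ubar (K *m Wc 1) ->
  mu * wdot mu (P *m Lambda) W W <= 2 * wdot mu (P *m Lambda) W G.
Proof.
move=> mu0 sQ dT hu lmi1 hWG [WWc cWc] bc.
have [hW hG _] := hWG.
have hWc := within_inL2 cWc.
rewrite (ae_wdot _ mu0 hW hW hWc hWc)// (ae_wdot _ mu0 hW hG hWc hG)//; last exact: aeW.
have := boundary_dissipation sQ dT hu lmi1 bc.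
have := wdot_by_parts (P *m Lambda) mu0 hG (fun i => H1_primitive i hWG (conj WWc cWc)).
rewrite (wdotC mu _ G) sQ /bil; move: (wdot _ _ _ _) (wdot _ _ _ _) => a b.
by move: (_ 0 0) (expR _ * _) => {hWG WWc cWc hW hG hWc lmi1 dT hu bc} *; lra.
Qed.

(** The block matrix is evaluated pointwise at (W, - D). *)
Lemma disturbance_young n q (P Gamma : 'M[R]_n) (N : 'M[R]_(n, q)) (mu chi : R) W D :
  0 <= mu -> symmetric_mx P ->
  psdmx (block_mx Gamma (P *m N) (N^T *m P) (chi ^+ 2)%:M) -> inL2 W -> inL2 D ->
  2 * wdot mu (P *m N) W D <= wdot mu Gamma W W + chi ^+ 2 * wdot mu 1%:M D D.
Proof.
move=> mu0 sP [_ lmi2] hW hD; rewrite -subr_ge0 addrAC.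
have iG := int01_wdot Gamma mu0 hW hW; have iD := int01_wdot 1%:M mu0 hD hD.
have iN := int01_wdot (P *m N) mu0 hW hD.
rewrite -!RintegralZl// -RintegralB//; last exact: int01Z.
rewrite -RintegralD//; [|by apply: int01B => //; exact: int01Z|exact: int01Z].
apply: Rintegral_ge0 => z _; have := lmi2 (col_mx (W z) (- D z)).
rewrite -/(bil _ (col_mx _ _) _) bil_block bilNr bilNl bilNr bilNl opprK.
have -> : bil (N^T *m P) (D z) (W z) = bil (P *m N) (W z) (D z).
  by rewrite [RHS]bilC trmx_mul sP.
have -> : bil (chi ^+ 2)%:M (D z) (D z) = chi ^+ 2 * bil 1%:M (D z) (D z).
  by rewrite -bilZm scalemx1.
rewrite -!/(bil _ _ _) => /(mulr_ge0 (expR_ge0 (- (mu * z)))).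
congr (0 <= _); ring.
Qed.

Lemma wdot_decay n (P Lambda Gamma : 'M[R]_n) (mu alpha : R) W :
  0 <= mu -> nsdmx (P *m (alpha%:M - mu *: Lambda) + Gamma) -> inL2 W ->
  alpha * wdot mu P W W + wdot mu Gamma W W <= mu * wdot mu (P *m Lambda) W W.
Proof.
move=> mu0 [_ lmi3] hW.
have : wdot mu (P *m (alpha%:M - mu *: Lambda) + Gamma) W W <= 0.
  rewrite -oppr_ge0 -mulN1r -wdotZm//; apply: Rintegral_ge0 => z _.
  rewrite mulr_ge0 ?expR_ge0// -/(bil _ _ _) bilZm mulN1r oppr_ge0; exact: lmi3.
have -> : P *m (alpha%:M - mu *: Lambda) = alpha *: P + (- mu) *: (P *m Lambda).
  by rewrite mulmxBr mul_mx_scalar -scalemxAr scaleNr.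
rewrite wdotDm// wdotDm// !wdotZm// mulNr addrAC subr_le0; exact.
Qed.

(** The source g of the step is compared with N D for an arbitrary square-integrable
D; in the application D runs over the values d(s) of the disturbance during the
step, and the inequality is integrated in s. *)
Lemma energy_step (n m q : nat) (Lambda Hcl : 'M[R]_n) (B : 'M[R]_(n, m))
  (K : 'M[R]_(m, n)) (N : 'M[R]_(n, q)) (ubar : 'cV[R]_m)
  (P Gamma : 'M[R]_n) (T : 'M[R]_m) (mu chi alpha c : R)
  (h : R) (W W' g Y : R -> 'cV[R]_n) (D : R -> 'cV[R]_q) :
  diag_pdmx Lambda -> (forall i, 0 < ubar i 0) -> diag_pdmx P -> diag_pdmx T ->
  0 <= mu ->
  nsdmx (block_mx
      (Hcl^T *m P *m Lambda *m Hcl - expR (- mu) *: (P *m Lambda))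
      (Hcl^T *m P *m Lambda *m B - K^T *m T)
      (Hcl^T *m P *m Lambda *m B - K^T *m T)^T
      (B^T *m P *m Lambda *m B - 2 *: T)) ->
  psdmx (block_mx Gamma (P *m N) (N^T *m P) (chi ^+ 2)%:M) ->
  nsdmx (P *m (alpha%:M - mu *: Lambda) + Gamma) ->
  (forall i, P i i <= c) -> 0 <= c ->
  0 < h -> opA Lambda Hcl B K ubar W Y -> inL2 W' -> inL2 g -> inL2 D ->
  eqL2 (fun z => h^-1 *: (W z - W' z)) (Y \+ g) ->
  (wdot mu P W W - wdot mu P W' W') / h + alpha * wdot mu P W W <=
  chi ^+ 2 * normL2 D ^+ 2 +
  2 * c * normL2 W * normL2 (opN N D \- g).
Proof.
move=> dL hu dP dT mu0 lmi1 lmi2 lmi3 hc c0 h0.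
move=> [G [Wc [hWG hWc bc YG]]] hW' hg hD hstep.
have [hW hG _] := hWG.
have hND : inL2 (opN N D) by exact: inL2M.
have hd := inL2B hND hg.
have pP : psdmx P by case: dP => _ /pd_psd.
have [sP _] := pP.
have sQ : symmetric_mx (P *m Lambda) by apply: diag_mul_sym; [case: dP|case: dL].
have hLG := inL2M Lambda hG; have hWW' := inL2B hW hW'.
have rhsE : eqL2 (fun z => h^-1 *: (W z - W' z)) (g \- (fun z => Lambda *m G z)).
  by apply: filterS2 YG hstep => z e1 e2 z01; rewrite e2//= e1// addrC.
(* the scheme expresses the increment through the right-hand side at W *)
have incr : wdot mu P W (W \- W') = h * (wdot mu P W g - wdot mu (P *m Lambda) W G).
  have -> : wdot mu P W (W \- W') = h * wdot mu P W (fun z => h^-1 *: (W z - W' z)).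
    by rewrite wdotZr// mulrA mulfV ?mul1r// gt_eqF.
  rewrite (ae_wdot P mu0 hW (inL2Z _ hWW') hW (inL2B hg hLG) (aeW _ (fun _ _ => erefl)) rhsE).
  by rewrite wdotBr// wdotMr.
have source : wdot mu P W g = wdot mu (P *m N) W D - wdot mu P W (opN N D \- g).
  by rewrite wdotBr// opprB addrC -wdotMr subrK.
have euler : (wdot mu P W W - wdot mu P W' W') / h <=
    2 * (wdot mu P W g - wdot mu (P *m Lambda) W G).
  by rewrite ler_pdivrMr// -mulrA [_ * h]mulrC -incr; exact: wdot_increment.
have := wdot_le_normM mu0 dP hc c0 hW hd; rewrite ler_norml => /andP[+ _].
have := ler_wpM2l (sqr_ge0 chi) (wdot1_le_norm mu0 hD).
have := disturbance_young mu0 sP lmi2 hW hD.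
have := transport_dissipation mu0 sQ dT hu lmi1 hWG hWc bc.
move: euler source (wdot_decay mu0 lmi3 hW).
rewrite -(mulrA 2 c) -(mulrA 2) -(mulrA c).
move: (wdot _ _ _ _) (wdot _ _ _ _) (wdot _ _ _ _) (wdot _ _ _ _) (wdot _ _ _ _).
clear; move: (wdot _ _ _ _) (wdot _ _ _ _) (wdot _ _ _ _).
by move=> *; lra.
Qed.

End dissipation.

(** * Extreme eigenvalues of a diagonal matrix *)

Section spectrum.
Context {R : realType}.
Local Notation leb := (@lebesgue_measure R).

(** The bounds below on lambda_max and lambda_min follow, since they are the
supremum and infimum of the diagonal entries. *)
Lemma diag_eigenvalueP k (M : 'M[R]_k) a : is_diag_mx M ->
  eigenvalue M a <-> exists i, a = M i i.
Proof.
move=> /diag_mxP[d ->]; split=> [/eigenvalueP[v vM v0]|[i ->]].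
  have /rV0Pn[i vi] := v0; exists i.
  have := congr1 (fun A : 'rV_k => A 0 i) vM.
  rewrite mul_mx_diag !mxE eqxx mulr1n [RHS]mulrC => /(mulfI vi) ->//.
apply/eigenvalueP; exists (delta_mx 0 i).
  apply/rowP => j; rewrite mul_mx_diag !mxE !eqxx mulr1n /=.
  by have [->|] := eqVneq j i; rewrite ?mul0r ?mulr0// mulrC.
by apply/rV0Pn; exists i; rewrite mxE !eqxx oner_neq0.
Qed.

Lemma diag_entry_le_lambda_max k (M : 'M[R]_k) i : is_diag_mx M ->
  M i i <= lambda_max M.
Proof.
move=> dM; apply: sup_upper_bound; last by apply/diag_eigenvalueP => //; exists i.
split; first by exists (M i i); apply/diag_eigenvalueP => //; exists i.
exists (\sum_j `|M j j|) => _ /(diag_eigenvalueP _ dM)[j ->].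
rewrite (le_trans (ler_norm _))// (bigD1 j)//= lerDl.
by apply: sumr_ge0 => *; exact: normr_ge0.
Qed.

Lemma lambda_min_gt0 k (M : 'M[R]_k) : (0 < k)%N -> diag_pdmx M ->
  0 < lambda_min M.
Proof.
case: k M => // k M _ pM; have dM := pM.1.
have [i _ hi] := @arg_minP _ _ _ (@ord0 k) xpredT (fun i => M i i) isT.
apply: (lt_le_trans (diag_entry_gt0 i pM)); apply: lb_le_inf.
  by exists (M i i); apply/diag_eigenvalueP => //; exists i.
by move=> _ /(diag_eigenvalueP _ dM)[j ->]; exact: hi.
Qed.

Lemma lambda_min_le_diag_entry k (M : 'M[R]_k) i : diag_pdmx M ->
  lambda_min M <= M i i.
Proof.
move=> pM; have dM := pM.1; apply: ge_inf; last first.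
  by apply/diag_eigenvalueP => //; exists i.
exists 0 => _ /(diag_eigenvalueP _ dM)[j ->]; exact/ltW/diag_entry_gt0.
Qed.

End spectrum.

(** * Energy of approximate solutions *)

Section approximation.
Context {R : realType}.
Local Notation leb := (@lebesgue_measure R).

(** The integral of a nonnegative function is a supremum over simple functions
below it, and as such is monotone without any measurability. *)
Lemma le_integral_nonmeasurable d (X : measurableType d) (nu : {measure set X -> \bar R})
    (D : set X) (f g : X -> \bar R) :
  (forall x, D x -> (0 <= f x)%E) -> (forall x, D x -> (f x <= g x)%E) ->
  (\int[nu]_(x in D) f x <= \int[nu]_(x in D) g x)%E.
Proof.
move=> f0 fg.
have g0 x : D x -> (0 <= g x)%E by move=> Dx; exact: le_trans (f0 _ Dx) (fg _ Dx).
rewrite !ge0_integralE//; apply: le_ereal_sup => _ [h/= hf <-].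
exists h => // x; apply: le_trans (hf x) _; exact: lee_restrict.
Qed.

(** In the application r is the norm of the defect N d(s) - g. It dominates
the measurable function max((a - f) / c, 0), and the latter is integrated. *)
Lemma le_integral_remainder (a c E x y : R) (f r : R -> R) : x < y -> 0 < c ->
  leb.-integrable `]x, y] (EFin \o f) ->
  (forall s, x < s <= y -> 0 <= r s) ->
  (forall s, x < s <= y -> a <= f s + c * r s) ->
  (\int[leb]_(s in `]x, y]) (r s)%:E = E%:E)%E ->
  (y - x) * a <= \int[leb]_(s in `]x, y]) f s + c * E.
Proof.
move=> xy c0 hf r0 har hE.
pose phi s := Num.max (c^-1 * (a - f s)) 0.
have ia : leb.-integrable `]x, y] (EFin \o cst a).
  apply: measurable_bounded_integrable => //.
    by rewrite /= lebesgue_measure_itv/= lte_fin xy -EFinB ltry.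
  by exists `|a|; split=> // M aM t _ /=; exact: ltW.
have iaf : leb.-integrable `]x, y] (EFin \o (fun s => a - f s)).
  by have := integrableB _ ia hf; apply.
have icaf : leb.-integrable `]x, y] (EFin \o (fun s => c^-1 * (a - f s))).
  by have := integrableZl _ c^-1 iaf; apply.
have iphi : leb.-integrable `]x, y] (EFin \o phi).
  by apply: integrable_funrpos icaf.
have hphi : (\int[leb]_(s in `]x, y]) (phi s)%:E <= E%:E)%E.
  rewrite -hE; apply: le_integral_nonmeasurable => s /=; rewrite in_itv/= => sxy.
    by rewrite lee_fin le_max lexx orbT.
  rewrite lee_fin ge_max r0// andbT -(ler_pM2l c0) mulrA mulfV ?gt_eqF// mul1r.
  by rewrite lerBlDl har.
have : \int[leb]_(s in `]x, y]) (c^-1 * (a - f s)) <= E.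
  apply: (@le_trans _ _ (\int[leb]_(s in `]x, y]) phi s)).
    by apply: le_Rintegral => // s _; rewrite le_max lexx.
  rewrite -lee_fin /Rintegral fineK//; exact: integrable_fin_num.
rewrite RintegralZl// -(ler_pM2l c0) mulrA mulfV ?gt_eqF// mul1r.
rewrite RintegralB// Rintegral_cst// [X in fine X]lebesgue_measure_itv/= lte_fin xy.
by rewrite -EFinB/= lerBlDl mulrC.
Qed.

(** Each factor 1 / (1 + alpha h) with h <= eps is at most
e^(-alpha h / (1 + alpha eps)), and the exponents add up to the elapsed time. *)
Lemma discrete_gronwall (alpha eps : R) (k : nat) (t V F : nat -> R) :
  0 < alpha -> 0 < eps -> t 0%N = 0 ->
  (forall i, (i < k)%N -> t i < t i.+1 /\ t i.+1 - t i < eps) ->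
  (forall i, 0 <= V i) -> (forall i, (i < k)%N -> 0 <= F i) ->
  (forall i, (i < k)%N -> V i.+1 * (1 + alpha * (t i.+1 - t i)) <= V i + F i) ->
  V k <= expR (- (alpha / (1 + alpha * eps) * t k)) * V 0%N + \sum_(i < k) F i.
Proof.
move=> a0 e0 t0 ht V0 F0 hV.
have ae : 0 < 1 + alpha * eps by rewrite ltr_pwDl// mulr_ge0 ?ltW.
set b := alpha / (1 + alpha * eps).
have b0 : 0 < b by rewrite divr_gt0.
have bE : b * (1 + alpha * eps) = alpha by rewrite mulfVK// gt_eqF.
elim: k ht F0 hV => [|k ih] ht F0 hV.
  by rewrite t0 mulr0 oppr0 expR0 mul1r big_ord0 addr0.
have {}ih := ih (fun i ik => ht i (ltnW ik)) (fun i ik => F0 i (ltnW ik))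
                (fun i ik => hV i (ltnW ik)).
have [tk te] := ht k (ltnSn k); have {}hV := hV k (ltnSn k); have Fk := F0 k (ltnSn k).
pose h := t k.+1 - t k; have h0 : 0 < h by rewrite subr_gt0.
(* from e^(-x) >= 1 - x and b (1 + alpha h) <= alpha *)
have key : 1 <= expR (- (b * h)) * (1 + alpha * h).
  have h1 : 1 - b * h <= expR (- (b * h)) by exact: expR_ge1Dx.
  have ah : 0 <= 1 + alpha * h by rewrite addr_ge0// mulr_ge0// ltW.
  apply: le_trans (ler_wpM2r ah h1).
  have bh : 0 <= b * h by rewrite mulr_ge0// ltW.
  have ahe : b * (1 + alpha * h) <= alpha.
    by rewrite -{2}bE ler_pM2l// lerD2l ler_pM2l// ltW.
  have := ler_wpM2r (ltW h0) ahe; clear; nra.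
have -> : expR (- (b * t k.+1)) = expR (- (b * h)) * expR (- (b * t k)).
  by rewrite -expRD; congr expR; rewrite /h; ring.
rewrite big_ord_recr/=.
have e1 : expR (- (b * h)) <= 1 by rewrite expR_le1 oppr_le0 mulr_ge0// ltW.
have s0 : 0 <= \sum_(i < k) F i.
  by apply: sumr_ge0 => i _; apply: F0; exact: leq_trans (ltn_ord i) (leqnSn k).
apply: (@le_trans _ _ (expR (- (b * h)) * (V k + F k))).
  apply: (@le_trans _ _ (expR (- (b * h)) * (V k.+1 * (1 + alpha * h)))).
    by rewrite mulrCA ler_peMr.
  by rewrite ler_wpM2l// expR_ge0.
rewrite mulrDr -mulrA addrA; apply: lerD; last exact: ler_piMl.
apply: le_trans (ler_wpM2l (expR_ge0 _) ih) _.
by rewrite mulrDr lerD2l ler_piMl.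
Qed.

Lemma sum_ord_le (F : nat -> R) (k M : nat) : (k <= M)%N ->
  (forall i, (i < M)%N -> 0 <= F i) -> \sum_(i < k) F i <= \sum_(i < M) F i.
Proof.
elim: M => [|M ih]; first by rewrite leqn0 => /eqP ->.
rewrite leq_eqVlt => /predU1P[->//|kM] F0.
rewrite big_ord_recr/= (le_trans (ih kM _))//.
  by move=> i iM; apply: F0; exact: ltnW.
by rewrite lerDl F0.
Qed.

Lemma sum_fine_lt (e : R) (M : nat) (E : nat -> \bar R) :
  (forall i, (0 <= E i)%E) -> (\sum_(i < M) E i < e%:E)%E ->
  (forall i, (i < M)%N -> E i = (fine (E i))%:E) /\ \sum_(i < M) fine (E i) < e.
Proof.
move=> E0 hE.
have fin i : (i < M)%N -> E i = (fine (E i))%:E.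
  move=> iM; rewrite fineK// ge0_fin_numE// (@le_lt_trans _ _ (\sum_(i < M) E i)%E)//.
    rewrite (bigD1 (Ordinal iM))//= leeDl//; exact: sume_ge0.
  exact: lt_trans hE (ltry _).
split=> //; rewrite -lte_fin -sumEFin (le_lt_trans _ hE)//.
by rewrite le_eqVlt; apply/orP; left; apply/eqP; apply: eq_bigr => i _; rewrite -fin.
Qed.

Lemma sum_integral_partition (f : R -> R) (t : nat -> R) (k : nat) :
  t 0%N = 0 -> (forall i, (i < k)%N -> t i <= t i.+1) ->
  leb.-integrable `]0, t k] (EFin \o f) ->
  \sum_(i < k) \int[leb]_(s in `]t i, t i.+1]) f s = \int[leb]_(s in `]0, t k]) f s.
Proof.
move=> t0; elim: k => [|k ih] ht hf.
  by rewrite big_ord0 t0 set_itv_ge ?bnd_simp ?ltxx// Rintegral_set0.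
have tk0 : 0 <= t k.
  rewrite -t0; elim: k {ih hf} ht => // k ih ht.
  by apply: le_trans (ht k _); [apply: ih => i ik; apply: ht; exact: leqW|exact: leqW].
have tk : t k <= t k.+1 by exact: ht.
have hfk : leb.-integrable `]0, t k] (EFin \o f).
  apply: integrableS hf => // s /=; rewrite !in_itv/= => /andP[-> st].
  exact: le_trans st tk.
rewrite big_ord_recr/= ih//; last by move=> i ik; apply: ht; exact: leqW.
by rewrite -(Rintegral_itvB (x := t k) hf) ?bnd_simp// addrC subrK.
Qed.

Lemma Rintegral_initial_le (f : R -> R) (s t : R) : 0 <= s -> s <= t ->
  (forall r, 0 <= f r) -> leb.-integrable `[0, t] (EFin \o f) ->
  \int[leb]_(r in `]0, s]) f r <= \int[leb]_(r in `[0, t]) f r.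
Proof.
move=> s0 st f0 hf.
rewrite Rintegral_itv_obnd_cbnd; last first.
  apply: integrableS hf => // r /=; rewrite !in_itv/= => /andP[r0 rs].
  by rewrite ltW//= (le_trans rs).
rewrite -subr_ge0 (Rintegral_itvB hf) ?bnd_simp//.
by apply: Rintegral_ge0.
Qed.

(** The node must not exceed tau, as the disturbance is only square-integrable up
to tau. *)
Lemma last_node_before (t : nat -> R) (M : nat) (tau e : R) : t 0%N = 0 ->
  0 <= tau -> (forall i, (i < M)%N -> t i.+1 - t i < e) -> tau - e < t M ->
  exists k, [/\ (k <= M)%N, t k <= tau & tau - e < t k].
Proof.
move=> t0 tau0 te tM.
have ex : exists k, (k <= M)%N && (t k <= tau) by exists 0%N; rewrite t0.
have ub k : (k <= M)%N && (t k <= tau) -> (k <= M)%N by case/andP.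
have [k /andP[kM tk] kmax] := ex_maxnP ex ub.
exists k; split=> //; move: kM; rewrite leq_eqVlt => /predU1P[->//|kM].
have := te _ kM; have : tau < t k.+1; last by move=> *; lra.
rewrite ltNge; apply/negP => tk1.
by have := kmax k.+1; rewrite kM tk1 => /(_ isT); rewrite ltnn.
Qed.

Lemma increasing_nodes (t : nat -> R) (M i j : nat) :
  (forall i, (i < M)%N -> t i < t i.+1) -> (i <= j)%N -> (j <= M)%N -> t i <= t j.
Proof.
move=> ht; elim: j => [|j ih]; first by rewrite leqn0 => /eqP ->.
rewrite leq_eqVlt => /predU1P[->//|ij] jM.
by rewrite (le_trans (ih ij (ltnW jM)))// ltW// ht.
Qed.

(** c bounds P from above and L bounds the trajectory on [0, tau]. The Euler iterates
are within eps of the trajectory at the nodes, hence bounded by L + eps, so that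
the defects contribute at most 2 c (L + eps) times the total error of the
approximation of N d, which is below eps. *)
Lemma approx_energy_bound (n m q : nat) (Lambda Hcl : 'M[R]_n) (B : 'M[R]_(n, m))
  (K : 'M[R]_(m, n)) (N : 'M[R]_(n, q)) (ubar : 'cV[R]_m)
  (P Gamma : 'M[R]_n) (T : 'M[R]_m) (mu chi alpha c : R)
  (eps Tbar tM tau L : R) (X0 : R -> 'cV[R]_n) (X w : R -> R -> 'cV[R]_n)
  (d : R -> R -> 'cV[R]_q) :
  diag_pdmx Lambda -> (forall i, 0 < ubar i 0) -> diag_pdmx P -> diag_pdmx T ->
  0 <= mu -> 0 < alpha ->
  nsdmx (block_mx
      (Hcl^T *m P *m Lambda *m Hcl - expR (- mu) *: (P *m Lambda))
      (Hcl^T *m P *m Lambda *m B - K^T *m T)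
      (Hcl^T *m P *m Lambda *m B - K^T *m T)^T
      (B^T *m P *m Lambda *m B - 2 *: T)) ->
  psdmx (block_mx Gamma (P *m N) (N^T *m P) (chi ^+ 2)%:M) ->
  nsdmx (P *m (alpha%:M - mu *: Lambda) + Gamma) ->
  (forall i, P i i <= c) -> 0 < c -> 0 < eps -> 0 <= L ->
  0 <= tau <= Tbar -> inL2 X0 ->
  (forall s : R, 0 <= s <= tau -> [/\ inL2 (X s), inL2 (d s) & normL2 (X s) <= L]) ->
  leb.-integrable `[0, tau] (fun s => (normL2 (d s) ^+ 2)%:E) ->
  approx_solution Lambda Hcl B K ubar eps Tbar X0 (fun s => opN N (d s)) tM w ->
  (forall s : R, 0 <= s <= tM -> normL2 (X s \- w s) <= eps) ->
  exists2 s : R, 0 <= s <= tau & [/\ tau - eps < s, inL2 (w s), normL2 (X s \- w s) <= eps &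
    wdot mu P (w s) (w s) <=
      expR (- (alpha / (1 + alpha * eps) * s)) * (c * (normL2 X0 + eps) ^+ 2) +
      (chi ^+ 2 * \int[leb]_(r in `[0, tau]) (normL2 (d r) ^+ 2) +
       2 * c * (L + eps) * eps)].
Proof.
move=> dL hu dP dT mu0 a0 lmi1 lmi2 lmi3 hc c0 e0 L0 /andP[tau0 tauT] hX0 hXd id.
move=> [M [t [g [W [[M0 t0 tME ht] [tMe tMT] [hg hE] [w0 hw hW] [hW0 hW0X]]]]]] hXw.
have tS i : (i < M)%N -> t i < t i.+1 by move=> /ht[].
have te i : (i < M)%N -> t i.+1 - t i < eps by move=> /ht[].
have [k [kM tk tke]] : exists k, [/\ (k <= M)%N, t k <= tau & tau - eps < t k].
  by apply: last_node_before => //; rewrite tME; lra.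
have tge0 i : (i <= M)%N -> 0 <= t i.
  by move=> iM; rewrite -t0; exact: increasing_nodes tS _ iM.
have tlek i : (i <= k)%N -> t i <= tau.
  by move=> ik; rewrite (le_trans _ tk)//; exact: increasing_nodes tS ik kM.
have tleM i : (i <= M)%N -> t i <= tM.
  by move=> iM; rewrite -tME; exact: increasing_nodes tS iM (leqnn _).
have wt i : (i <= M)%N -> w (t i) = W i.
  by case: i => [|i] iM; [rewrite t0|apply: hw (tS _ iM) (lexx _)].
have hWL i : (i <= M)%N -> inL2 (W i).
  by case: i => [//|i] iM; have [Y [G [Xc [[]]]]] := hW _ iM.
(* at the nodes up to tau the iterates inherit the bound on the trajectory *)
have WL i : (i <= k)%N -> normL2 (W i) <= L + eps.
  move=> ik; have iM := leq_trans ik kM.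
  have [hX _ hXL] : [/\ inL2 (X (t i)), inL2 (d (t i)) & normL2 (X (t i)) <= L].
    by apply: hXd; rewrite tge0// tlek.
  have h := hXw (t i); rewrite wt// in h.
  apply: le_trans (normL2_tri (hWL _ iM) hX) _; apply: lerD hXL _.
  by rewrite (normL2_distC (hWL _ iM) hX); apply: h; rewrite tge0// tleM.
pose E i : \bar R := (\int[leb]_(s in `]t i, t i.+1]) (normL2 (opN N (d s) \- g i))%:E)%E.
have E0 i : (0 <= E i)%E by apply: integral_ge0 => s _; rewrite lee_fin normL2_ge0.
have [Efin Esum] := sum_fine_lt E0 hE.
have iD : leb.-integrable `[0, tau] (EFin \o (fun s => chi ^+ 2 * normL2 (d s) ^+ 2)).
  by have := integrableZl _ (chi ^+ 2) id; apply.
have cL : 0 < 2 * c * (L + eps) by rewrite !mulr_gt0// ltr_wpDl.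
pose F i := \int[leb]_(s in `]t i, t i.+1]) (chi ^+ 2 * normL2 (d s) ^+ 2) +
            2 * c * (L + eps) * fine (E i).
have F0 i : (i < k)%N -> 0 <= F i.
  move=> ik; rewrite addr_ge0//.
    by apply: Rintegral_ge0 => s _; rewrite mulr_ge0 ?sqr_ge0.
  by rewrite mulr_ge0 ?(ltW cL)// fine_ge0.
have step i : (i < k)%N -> wdot mu P (W i.+1) (W i.+1) * (1 + alpha * (t i.+1 - t i)) <=
    wdot mu P (W i) (W i) + F i.
  move=> ik; have iM := leq_trans ik kM.
  have [Y hA hY] := hW _ iM; have ti := tS _ iM.
  have h0 : 0 < t i.+1 - t i by rewrite subr_gt0.
  have in_tau s : t i < s <= t i.+1 -> 0 <= s <= tau.
    move=> /andP[s1 s2]; rewrite (le_trans s2 (tlek _ ik)) andbT.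
    exact: le_trans (tge0 _ (ltnW iM)) (ltW s1).
  have idi : leb.-integrable `]t i, t i.+1] (EFin \o (fun s => chi ^+ 2 * normL2 (d s) ^+ 2)).
    by apply: integrableS iD => // s /=; rewrite !in_itv/=; exact: in_tau.
  (* the step inequality, at each time s of the step *)
have bound s : t i < s <= t i.+1 ->
    (wdot mu P (W i.+1) (W i.+1) - wdot mu P (W i) (W i)) / (t i.+1 - t i) +
      alpha * wdot mu P (W i.+1) (W i.+1) <=
    chi ^+ 2 * normL2 (d s) ^+ 2 + 2 * c * (L + eps) * normL2 (opN N (d s) \- g i).
    move=> /in_tau/hXd[_ hd _].
    apply: le_trans (energy_step dL hu dP dT mu0 lmi1 lmi2 lmi3 hc (ltW c0) h0 hA
      (hWL _ (ltnW iM)) (hg _ iM) hd hY) _.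
    rewrite lerD2l ler_wpM2r ?normL2_ge0// ler_pM2l ?mulr_gt0//; exact: WL.
  have := le_integral_remainder ti cL idi (fun s _ => normL2_ge0 _) bound (Efin _ iM).
  rewrite -/(F i) mulrDr mulrCA mulfV ?gt_eqF// mulr1 addrAC lerBlDl.
  congr (_ <= _); ring.
have := discrete_gronwall a0 e0 t0 (fun i ik => ht i (leq_trans ik kM))
  (fun i => wdot_ge0 mu (W i) (pd_psd dP.2)) F0 step.
move=> gron; exists (t k); first by rewrite tge0.
rewrite (wt _ kM); split; [exact: tke|exact: hWL| |].
  by rewrite -(wt _ kM); apply: hXw; rewrite tge0// tleM.
apply: le_trans gron _; apply: lerD.
  rewrite ler_wpM2l ?expR_ge0// (le_trans (wdot_le_norm mu0 dP hc hW0))//.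
  rewrite ler_pM2l// ler_sqr ?nnegrE ?addr_ge0 ?normL2_ge0 ?(ltW e0)//.
  by rewrite (le_trans (normL2_tri hW0 hX0))// lerD2l.
rewrite /F big_split/= -mulr_sumr; apply: lerD.
  rewrite sum_integral_partition//.
  - rewrite -RintegralZl//.
    apply: (Rintegral_initial_le (f := fun s => chi ^+ 2 * normL2 (d s) ^+ 2)) => //.
      exact: tge0.
    by move=> r; rewrite mulr_ge0 ?sqr_ge0.
  - by move=> i ik; rewrite ltW// tS// (leq_trans ik).
  - apply: integrableS iD => // s /=; rewrite !in_itv/= => /andP[s0 sk].
    by rewrite ltW//= (le_trans sk).
rewrite ler_pM2l// (le_trans _ (ltW Esum))//.
by apply: (sum_ord_le (F := fun i => fine (E i))) => // i _; rewrite fine_ge0.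
Qed.

End approximation.

(** * Passage to the limit *)

Section limit.
Context {R : realType}.
Local Notation leb := (@lebesgue_measure R).

(** The bound that [approx_energy_bound] gives for the norm at precision eps, with a
node at distance at most eps before t, is continuous at eps = 0. *)
Lemma cvg_approx_bound (C alpha t a b c e f : R) :
  (fun eps : R => Num.sqrt (C * (expR (- (alpha / (1 + alpha * eps) * (t - eps))) *
     (a * (b + eps) ^+ 2) + (c + e * (f + eps) * eps)))) @ (0 : R) -->
  Num.sqrt (C * (expR (- (alpha * t)) * (a * b ^+ 2) + c)).
Proof.
have hid : (fun eps : R => eps) @ (0 : R) --> (0 : R) by exact: cvg_id.
have hc (k : R) : (fun eps : R => k) @ (0 : R) --> k by exact: cvg_cst.
have -> : C * (expR (- (alpha * t)) * (a * b ^+ 2) + c) =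
    C * (expR (- (alpha / (1 + alpha * 0) * (t - 0))) * (a * ((b + 0) * (b + 0))) +
         (c + e * (f + 0) * 0)).
  by rewrite !mulr0 !addr0 subr0 divr1 expr2.
under eq_fun do rewrite expr2.
apply: (@cvg_comp _ _ _ _ Num.sqrt _ _ _ _ (@sqrt_continuous _ _)).
apply: (cvgM (hc _)); apply: cvgD.
  apply: cvgM.
    apply: (@cvg_comp _ _ _ _ expR _ _ _ _ (@continuous_expR _ _)).
    apply: cvgN; apply: cvgM; last exact: (cvgB (hc _) hid).
    apply: (cvgM (hc _)); apply: cvgV; first by rewrite mulr0 addr0 oner_neq0.
    exact: (cvgD (hc _) (cvgM (hc _) hid)).
  by apply: (cvgM (hc _)); apply: cvgM; exact: (cvgD (hc _) hid).
apply: (cvgD (hc _)); apply: (cvgM _ hid); apply: (cvgM (hc _)).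
exact: (cvgD (hc _) hid).
Qed.

Lemma le_at_zero_of_cvg (x : R) (Psi : R -> R) (l : R) :
  Psi @ (0 : R) --> l ->
  (forall eta, 0 < eta -> exists2 e0 : R, 0 < e0 & forall e, 0 < e < e0 ->
     x <= 2 * eta + Psi e) ->
  x <= l.
Proof.
move=> /cvgrPdist_lt hPsi h; apply/ler_addgt0Pr => eta eta0.
have e3 : 0 < eta / 3 by rewrite divr_gt0.
have [e0 e00 he] := h _ e3.
have /nbhs_ballP[d d0 hd] := hPsi _ e3.
(* a precision admissible for both hypotheses, strictly below the minimum *)
pose e := Num.min e0 d / 2.
have m0 : 0 < Num.min e0 d by rewrite lt_min e00.
have e_gt0 : 0 < e by rewrite divr_gt0.
have em : e < Num.min e0 d by rewrite ltr_pdivrMr// mulrDr mulr1 ltrDl.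
move: em; rewrite lt_min => /andP[ee0 ed].
have := hd e; rewrite /ball/= sub0r normrN gtr0_norm// => /(_ ed).
have := he e; rewrite e_gt0 ee0 => /(_ isT).
by rewrite ltr_norml; move: (Psi e) => p; clear; move=> ? /andP[? ?]; lra.
Qed.

(** Separates the contributions of the initial state and of the disturbance. *)
Lemma sqrt_addsq_le (a b : R) : 0 <= a -> 0 <= b ->
  Num.sqrt (a ^+ 2 + b ^+ 2) <= a + b.
Proof.
move=> a0 b0; rewrite -[leRHS]ger0_norm ?addr_ge0// -sqrtr_sqr.
by rewrite ler_wsqrtr// sqrrD lerD2r lerDl mulrn_wge0 ?mulr_ge0.
Qed.

Lemma normL2_bounded n (X : R -> R -> 'cV[R]_n) (I : set R) (t : R) : 0 <= t ->
  `[0, t]%classic `<=` I -> continuous_L2 I X ->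
  exists2 L : R, 0 <= L & forall s, 0 <= s <= t -> normL2 (X s) <= L.
Proof.
move=> t0 tI [hX cX].
have cN : {within `[0, t], continuous (fun s => normL2 (X s))}.
  apply/subspace_continuousP => s /= hs; have sI := tI _ hs.
  apply/cvgrPdist_lt => e e0.
  have /cvgrPdist_lt/(_ e e0) := cX s sI.
  rewrite !near_withinE; apply: filterS => r /[swap] hr /(_ (tI _ hr)).
  have rI := tI _ hr.
  rewrite sub0r normrN ger0_norm ?normL2_ge0// -/(normL2 (X r \- X s)) => he.
  have h1 := normL2_tri (hX _ rI) (hX _ sI).
  have h2 := normL2_tri (hX _ sI) (hX _ rI).
  rewrite (normL2_distC (hX _ sI) (hX _ rI)) in h2.
  rewrite /from_subspace; move: h1 h2 he; clear; move: (normL2 (X r)) (normL2 (X s)) => p p'.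
  by move=> *; rewrite ltr_norml; apply/andP; split; lra.
have [s _ hs] := EVT_max t0 cN.
exists (normL2 (X s)); first exact: normL2_ge0.
by move=> r hr; apply: hs; rewrite in_itv.
Qed.

End limit.

(** * The stability estimate *)

(** Treats bounded and unbounded time domains at once. *)
Lemma mild_horizon (R : realType) (n m q : nat) (Lambda Hcl : 'M[R]_n)
  (B : 'M[R]_(n, m)) (K : 'M[R]_(m, n)) (ubar : 'cV[R]_m) (N : 'M[R]_(n, q))
  (I : set R) (X0 : R -> 'cV[R]_n) (X : R -> R -> 'cV[R]_n)
  (d : R -> R -> 'cV[R]_q) (t : R) :
  (exists2 Tbar : R, 0 < Tbar &
     I = `[0, Tbar]%classic /\ mild_on Lambda Hcl B K ubar N Tbar X0 X d) \/
  (I = `[0, +oo[%classic /\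
     forall Tbar : R, 0 < Tbar -> mild_on Lambda Hcl B K ubar N Tbar X0 X d) ->
  I t -> [/\ 0 <= t, measurable I, `[0, t]%classic `<=` I &
    exists2 Tbar : R, t <= Tbar & mild_on Lambda Hcl B K ubar N Tbar X0 X d].
Proof.
move=> [[Tbar T0 [-> hm]]|[-> hm]] /=; rewrite in_itv/=.
  move=> /andP[t0 tT]; split=> //; last by exists Tbar.
  by move=> s /=; rewrite !in_itv/= => /andP[-> st]; exact: le_trans st tT.
rewrite andbT => t0; split=> //.
  by move=> s /=; rewrite !in_itv/= => /andP[-> _].
by exists (t + 1); [rewrite lerDl|apply: hm; rewrite ltr_wpDl].
Qed.

Theorem theorem2 (R : realType) (n m q : nat) (n_gt0 : (0 < n)%N)
  (Lambda H : 'M[R]_n) (B : 'M[R]_(n, m)) (N : 'M[R]_(n, q))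
  (ubar : 'cV[R]_m) (K : 'M[R]_(m, n))
  (Lambda_pd : diag_pdmx Lambda) (ubar_gt0 : forall i, 0 < ubar i 0) :
  let Hcl := H + B *m K in
  forall (P : 'M[R]_n) (T : 'M[R]_m) (mu chi alpha : R) (Gamma : 'M[R]_n),
    diag_pdmx P -> diag_pdmx T -> 0 < mu -> 0 < chi -> 0 < alpha ->
    pdmx Gamma ->
    nsdmx (block_mx
      (Hcl^T *m P *m Lambda *m Hcl - expR (- mu) *: (P *m Lambda))
      (Hcl^T *m P *m Lambda *m B - K^T *m T)
      (Hcl^T *m P *m Lambda *m B - K^T *m T)^T
      (B^T *m P *m Lambda *m B - 2 *: T)) ->
    psdmx (block_mx Gamma (P *m N) (N^T *m P) (chi ^+ 2)%:M) ->
    nsdmx (P *m (alpha%:M - mu *: Lambda) + Gamma) ->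
    let omega := alpha / 2 in
    let kappa := Num.sqrt (lambda_max P / lambda_min P) * expR (mu / 2) in
    let gamma := chi / Num.sqrt (lambda_min P) * expR (mu / 2) in
    forall (I : set R) (X0 : R -> 'cV[R]_n)
      (X : R -> R -> 'cV[R]_n) (d : R -> R -> 'cV[R]_q),
      mild_solution_pair Lambda Hcl B K ubar N I X0 X d ->
      forall t, I t ->
        ((normL2 (X t))%:E <=
          (kappa * expR (- (omega * t)) * normL2 X0)%:E +
          gamma%:E * sqrte (\int[@lebesgue_measure R]_(theta in `[0%R, t])
                              (normL2 (d theta) ^+ 2)%:E))%E.
Proof.
move=> Hcl P T mu chi alpha Gamma dP dT mu_gt0 chi0 a0 pG lmi1 lmi2 lmi3.
move=> omega kappa gamma I X0 X d [hX0 cX [hd _ id] _ hm] t It.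
have [t0 mI tI [Tbar tT hmild]] := mild_horizon hm It.
have mu0 := ltW mu_gt0.
have lmin0 : 0 < lambda_min P := lambda_min_gt0 n_gt0 dP.
have lmaxP i : P i i <= lambda_max P by apply: diag_entry_le_lambda_max; case: dP.
have lmax0 : 0 < lambda_max P.
  exact: lt_le_trans (diag_entry_gt0 (Ordinal n_gt0) dP) (lmaxP _).
have gamma0 : 0 < gamma by rewrite /gamma mulr_gt0 ?expR_gt0// divr_gt0// sqrtr_gt0.
set J := (\int[_]_(_ in _) _)%E.
have J0 : (0 <= J)%E by apply: integral_ge0 => s _; rewrite lee_fin sqr_ge0.
(* the bound is vacuous for a disturbance of infinite energy, as gamma > 0 *)
have [->|Jfin] := eqVneq J +oo%E.
  by rewrite /= gt0_muley ?lte_fin// addey ?leey.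
have id2 : (@lebesgue_measure R).-integrable `[0, t] (fun s => (normL2 (d s) ^+ 2)%:E).
  apply/integrableP; split.
    apply/measurable_EFinP; apply: measurable_funX.
    have /integrableP[/measurable_EFinP + _] := id; exact: measurable_funS.
  rewrite (_ : (\int[_]_(_ in _) _)%E = J) ?lt_neqAle ?Jfin ?leey//.
  by apply: eq_integral => s _ /=; rewrite ger0_norm ?sqr_ge0.
have [L L0 hL] := normL2_bounded t0 tI cX.
pose j := \int[(@lebesgue_measure R)]_(s in `[0, t]) (normL2 (d s) ^+ 2).
have JE : J = j%:E by rewrite /j /Rintegral fineK//; exact: integrable_fin_num.
have j0 : 0 <= j by apply: Rintegral_ge0 => s _; exact: sqr_ge0.
rewrite JE /= -EFinM -EFinD lee_fin.
have C0 : 0 < expR (- mu) * lambda_min P by rewrite mulr_gt0 ?expR_gt0.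
have main : normL2 (X t) <= Num.sqrt ((expR (- mu) * lambda_min P)^-1 *
    (expR (- (alpha * t)) * (lambda_max P * normL2 X0 ^+ 2) + chi ^+ 2 * j)).
  apply: (le_at_zero_of_cvg (@cvg_approx_bound R (expR (- mu) * lambda_min P)^-1
    alpha t (lambda_max P) (normL2 X0) (chi ^+ 2 * j) (2 * lambda_max P) L)).
  move=> eta eta0; have [hX /(_ t It) /cvgrPdist_lt/(_ eta eta0)] := cX.
  rewrite near_withinE => /nbhs_ballP[e1 e10 he1].
  exists (Num.min e1 eta); first by rewrite lt_min e10.
  move=> e /andP[e0]; rewrite lt_min => /andP[ee1 eeta].
  have [tM [w [happ hXw]]] := hmild _ e0.
  have hdata s : 0 <= s <= t -> [/\ inL2 (X s), inL2 (d s) & normL2 (X s) <= L].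
    move=> st; have Is : I s by apply: tI; rewrite /= in_itv.
    by split; [exact: hX|exact: hd|exact: hL].
  have tT' : 0 <= t <= Tbar by rewrite t0.
  have [s st [ts hws hXs hV]] := approx_energy_bound Lambda_pd ubar_gt0 dP dT mu0 a0
    lmi1 lmi2 lmi3 lmaxP lmax0 e0 L0 tT' hX0 hdata id2 happ hXw.
  have [hXs2 _ _] := hdata _ st; have hXt := hX _ It.
  have Is : I s by apply: tI; rewrite /= in_itv.
  have near_t : normL2 (X t \- X s) < eta.
    have := he1 s; rewrite /ball/= sub0r normrN (ger0_norm (normL2_ge0 _)).
    rewrite (normL2_distC hXt hXs2); apply=> //; case/andP: st => s0 st.
    by rewrite ger0_norm ?subr_ge0//; move: ts ee1; clear; lra.
  have hw2 : normL2 (w s) <= Num.sqrt ((expR (- mu) * lambda_min P)^-1 *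
     (expR (- (alpha / (1 + alpha * e) * (t - e))) * (lambda_max P * (normL2 X0 + e) ^+ 2) +
      (chi ^+ 2 * j + 2 * lambda_max P * (L + e) * e))).
    rewrite -[leLHS]ger0_norm ?normL2_ge0// -sqrtr_sqr ler_wsqrtr//.
    rewrite -(ler_pM2l C0) mulVKf ?gt_eqF//.
    apply: le_trans (norm_le_wdot mu0 dP (ltW lmin0)
      (fun i => lambda_min_le_diag_entry i dP) hws) _.
    apply: le_trans hV _; rewrite lerD2r ler_wpM2r//.
      by rewrite mulr_ge0 ?sqr_ge0// ltW.
    rewrite ler_expR lerN2 ler_wpM2l// ?(ltW ts)//.
    by rewrite divr_ge0 ?(ltW a0)// addr_ge0// mulr_ge0 ?ltW.
  have h1 := normL2_tri hXt hXs2; have h2 := normL2_tri hXs2 hws.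
  move: hw2 h1 h2 hXs near_t eeta; clear; move: (Num.sqrt _) => S.
  by move=> *; lra.
apply: le_trans main _; have -> : (expR (- mu) * lambda_min P)^-1 *
    (expR (- (alpha * t)) * (lambda_max P * normL2 X0 ^+ 2) + chi ^+ 2 * j) =
    (kappa * expR (- (omega * t)) * normL2 X0) ^+ 2 + (gamma * Num.sqrt j) ^+ 2.
  have sqE (x : R) : expR (x / 2) ^+ 2 = expR x.
    by rewrite -expRM_natr divfK// pnatr_eq0.
  (* halving alpha makes the decay factor a square *)
  have -> : - (omega * t) = - (alpha * t) / 2 by rewrite /omega; field.
  rewrite /kappa /gamma; move: (normL2 X0) => r.
  rewrite !exprMn exprVn !sqE !sqr_sqrtr ?divr_ge0 ?(ltW lmax0) ?(ltW lmin0)//.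
  rewrite invfM -expRN opprK; field; exact: lt0r_neq0.
apply: sqrt_addsq_le.
  by rewrite !mulr_ge0 ?sqrtr_ge0 ?expR_ge0 ?normL2_ge0.
by rewrite mulr_ge0 ?sqrtr_ge0// ltW.
Qed.
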